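(* Hex-splines are not refinable: let $L\subset\mathbb{R}^2$ be a lattice whose Voronoi cell is a regular hexagon $V$. Then for every integer $m\ge 1$ and every $0<\lambda<1$, the hex-splines of order $m$ on $L$ cannot all be represented as linear combinations of the hex-splines of order $m$ on the scaled lattice $\lambda L$.
   Context: The Voronoi cell of a lattice $L$ is $\{x : |x|\le |x-l| \text{ for all } l\in L\}$; its translates by $L$ tessellate the plane by hexagons. The hex-splines of order $m$ on $L$ are the functions $\varphi(\cdot-l)$, $l\in L$, where $\varphi$ is the $m$-fold convolution of the indicator function of $V$ with itself ($m=1$: the indicator function itself). The hex-splines of order $m$ on $\lambda L$ are defined in the same way from the Voronoi cell $\lambda V$ of $\lambda L$. Linear combinations may be infinite (the sums are locally finite), and equality of functions is understood almost everywhere. *)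

(* Defs.v *)
(* MathComp-Analysis; the plane is R * R for an arbitrary R : realType. *)
From HB Require Import structures.
From mathcomp Require Import all_boot all_order all_algebra.
From mathcomp Require Import all_classical all_reals all_analysis.

Set Implicit Arguments.
Unset Strict Implicit.
Unset Printing Implicit Defensive.

Import Order.TTheory GRing.Theory Num.Theory.
Import numFieldNormedType.Exports.

Local Open Scope classical_set_scope.
Local Open Scope ring_scope.

(* The library norm on R * R is the sup norm, hence this one. *)
Definition enorm (R : realType) (x : R * R) : R :=
  Num.sqrt (x.1 ^+ 2 + x.2 ^+ 2).

Definition area (R : realType) :=
  ((@lebesgue_measure R) \x (@lebesgue_measure R))%E.

(* Full-rank lattices: integer combinations of two linearly independent
   vectors. *)
Definition is_lattice (R : realType) (L : set (R * R)) : Prop :=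
  exists a b : R * R,
    a.1 * b.2 - a.2 * b.1 != 0 /\
    L = [set x | exists i j : int, x = a *~ i + b *~ j].

Definition scaled (R : realType) (lambda : R) (A : set (R * R)) :
  set (R * R) := [set lambda *: x | x in A].

Definition voronoi (R : realType) (L : set (R * R)) : set (R * R) :=
  [set x | forall l, L l -> enorm x <= enorm (x - l)].

Definition convex_hull_of (R : realType) (n : nat) (v : 'I_n -> R * R) :
  set (R * R) :=
  [set x | exists t : 'I_n -> R,
    [/\ forall k, 0 <= t k, \sum_(k < n) t k = 1 &
        x = \sum_(k < n) t k *: v k]].

(* Closed solid hexagon with arbitrary centre c, circumradius r and
   orientation theta. *)
Definition is_regular_hexagon (R : realType) (A : set (R * R)) : Prop :=
  exists (c : R * R) (r theta : R),
    0 < r /\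
    A = convex_hull_of (fun k : 'I_6 =>
          c + r *: (cos (theta + k%:R * (pi / 3)),
                    sin (theta + k%:R * (pi / 3)))).

Definition convolution (R : realType) (f g : R * R -> R) : R * R -> R :=
  fun x => \int[@area R]_y (f y * g (x - y)).

(* m factors \1_V and m - 1 convolutions; meaningful for m >= 1 only (m = 0
   gives the same value as m = 1). *)
Definition hex_spline (R : realType) (L : set (R * R)) (m : nat) :
  R * R -> R :=
  iter m.-1 (convolution (\1_(voronoi L))) (\1_(voronoi L)).

(* Possibly infinite linear combinations of the hex-splines of order m on L.
   The finitely supported sum is the genuine one for a lattice L: hex_spline L m
   has bounded support, so for every x only finitely many k contribute. Only
   the values of c on L matter. *)
Definition hex_lincomb (R : realType) (L : set (R * R)) (m : nat)
    (c : R * R -> R) : R * R -> R :=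
  fun x => \sum_(k \in L) c k * hex_spline L m (x - k).

(* Main.v *)
(* Let V be the cell, and test a representation of the order-m spline f on L by
   the order-m splines on lambda L against a compactly supported theta. Since f
   is an m-fold convolution, <f(. - l), theta> = (A^m theta)(l), where A theta
   is the correlation of theta with 1_V, and similarly with the correlation
   A' with 1_(lambda V). It is thus enough to find theta such that A'^m theta
   vanishes on lambda L while A^m theta does not vanish at 0.
   Use coordinates (x_1, x_2) in which the vertices of V are +-(1, 0),
   +-(0, 1), +-(1, 1) and L is contained in {(i, j) : 3 | i + j}. By the
   fundamental theorem of calculus A d_1 d_2 (d_1 + d_2) is a signed sum of
   first derivatives at the six vertices. Take
   theta = (d_1 d_2 (d_1 + d_2) (1 + tau + tau^2))^m phi
   with tau the translation by lambda along x_2 and phi a bump around a point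
   P, flat in the direction x_2. If the bump is narrow, only the terms in
   d_1^m phi (P) survive, which leaves difference operators acting on the
   indicator function of P. On the fine side these are powers of (1 - tau^3) S
   where S, like 1 - tau^3, respects the classes of i + j mod 3, so A'^m theta
   vanishes on lambda L if P is in a wrong class. On the coarse side the extreme
   column x_1 = m keeps, up to sign, the coefficient 1 for P = (m, 0) and m for
   P = (m, lambda), the latter because lambda < 1; one of the two points is in a
   wrong class. *)
Require Import Defs.
From HB Require Import structures.
From mathcomp Require Import all_boot all_order all_algebra.
From mathcomp Require Import all_classical all_reals all_analysis.
From mathcomp Require Import measurable_realfun ring lra zify.

Set Implicit Arguments.
Unset Strict Implicit.
Unset Printing Implicit Defensive.

Import Order.TTheory GRing.Theory Num.Theory.
Import numFieldNormedType.Exports.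

Local Open Scope classical_set_scope.
Local Open Scope ring_scope.

(** * Linear changes of variables in the plane *)

Section area_measure.
Local Open Scope ereal_scope.
Variable R : realType.
Let mu : {sigma_finite_measure set (measurableTypeR R) -> \bar R} :=
  @lebesgue_measure R.
Let mu2 : {measure set (measurableTypeR R * measurableTypeR R)%type -> \bar R}
  :=
  mu \x mu.

Let area0 : @area R set0 = 0. Proof. exact: (measure0 mu2). Qed.
Let area_ge0 A : 0 <= @area R A. Proof. exact: (measure_ge0 mu2). Qed.
Let area_sigma : semi_sigma_additive (@area R).
Proof. exact: (@measure_semi_sigma_additive _ _ _ mu2). Qed.

(* The canonical sigma-finite structure of [\x] only applies to
   subprobabilities, hence the instances on [area]. *)
HB.instance Definition _ := isMeasure.Build _ _ _ (@area R)
  area0 area_ge0 area_sigma.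

Let area_sigma_finite : sigma_finite setT (@area R).
Proof.
have /sigma_finiteP[F [TF ndF Foo]] := sigma_finiteT mu.
exists (fun n => F n `*` F n).
  rewrite -setXTT {1 2}TF predeqE => -[x y]; split.
    move=> [/= [n _ Fnx] [k _ Gky]]; exists (maxn n k) => //; split.
    - by move: x Fnx; exact/subsetPset/ndF/leq_maxl.
    - by move: y Gky; exact/subsetPset/ndF/leq_maxr.
  by move=> [n _ []/= ? ?]; split; exists n.
move=> k; have [? ?] := Foo k.
split; first exact: measurableX.
rewrite [X in (X < _)%E](@product_measure1E _ _ _ _ _ mu mu)//.
by rewrite lte_mul_pinfty// ge0_fin_numE.
Qed.

HB.instance Definition _ := Measure_isSigmaFinite.Build _ _ _ (@area R)
  area_sigma_finite.

End area_measure.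

Section change_of_variables.
Local Open Scope ereal_scope.
Variable R : realType.
Let mu : {sigma_finite_measure set (measurableTypeR R) -> \bar R} :=
  @lebesgue_measure R.

Lemma measurable_affine (c t : R) : measurable_fun [set: R]
  (fun y : R => c * y + t)%R.
Proof. by apply: measurable_funD => //; exact: measurable_funM. Qed.

(** By uniqueness of Lebesgue measure it suffices to compare both sides on half-open intervals. A
    negative slope turns []a, b]] into an interval closed on the other side, of the same scaled
    length. *)
Lemma lebesgue_measure_affine (c t : R) (A : set R) :
  c != 0%R -> measurable A ->
  `|c|%:E * lebesgue_measure ((fun y : R => c * y + t)%R @^-1` A) =
    lebesgue_measure A.
Proof.
move=> c0 mA.
pose ph := fun y : measurableTypeR R => (c * y + t)%R : measurableTypeR R.
have mph : measurable_fun setT ph := measurable_affine c t.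
pose nu0 : {measure set (measurableTypeR R) -> \bar R} :=
  mscale (NngNum (normr_ge0 c)) (pushforward mu ph).
pose nu := nu0 mph.
suff -> : lebesgue_measure A = nu A by [].
apply: lebesgue_measure_unique mA => X /ocitvP[->|[[a b] /= ab ->]].
  by rewrite !measure0.
rewrite /nu /= /mscale /= /pushforward /=.
have [c_gt0|c_lt0|] := ltgtP 0%R c; last by move/esym/eqP; rewrite (negPf c0).
- have -> : ph @^-1` `]a, b]%classic = `]((a - t) / c)%R,
  ((b - t) / c)%R]%classic.
    apply/seteqP; split => y /=;
      rewrite !in_itv /= ltr_pdivrMr// ler_pdivlMr// /ph;
    lra.
  rewrite !lebesgue_measure_itv /= !lte_fin ltr_pM2r ?invr_gt0//.
  rewrite ltrD2r; case: ifPn => _; last by rewrite mule0.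
  rewrite gtr0_norm// -!EFinD -EFinM; congr _%:E; field.
  by rewrite gt_eqF.
- have -> : ph @^-1` `]a, b]%classic = `[((b - t) / c)%R,
  ((a - t) / c)%R[%classic.
    apply/seteqP; split => y /=;
      rewrite !in_itv /= ltr_ndivlMr// ler_ndivrMr// /ph;
    lra.
  rewrite !lebesgue_measure_itv /= !lte_fin ltr_nM2r ?invr_lt0//.
  rewrite ltrD2r; case: ifPn => _; last by rewrite mule0.
  rewrite ltr0_norm// -!EFinD -EFinM; congr _%:E; field.
  by rewrite lt_eqF.
Qed.

Lemma ge0_integral_affine (h : R -> \bar R) (c t : R) : c != 0%R ->
  measurable_fun setT h -> (forall y, 0 <= h y) ->
  `|c|%:E * \int[mu]_y h (c * y + t)%R = \int[mu]_y h y.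
Proof.
move=> c0 mh h0.
pose ph := fun y : measurableTypeR R => (c * y + t)%R : measurableTypeR R.
have mph : measurable_fun setT ph := measurable_affine c t.
pose nu0 : {measure set (measurableTypeR R) -> \bar R} :=
  mscale (NngNum (normr_ge0 c)) (pushforward mu ph).
pose nu := nu0 mph.
rewrite (_ : \int[mu]_y h y = \int[nu]_y h y); last first.
  by apply: eq_measure_integral => A mA _;
    exact/esym/(lebesgue_measure_affine t c0 mA).
by rewrite /nu ge0_integral_mscale//= ge0_integral_pushforward.
Qed.

End change_of_variables.

Definition lin (R : realType) (p q w : R * R) : R * R :=
  (p.1 * w.1 + q.1 * w.2, p.2 * w.1 + q.2 * w.2).

Definition cross (R : realType) (p q : R * R) : R := p.1 * q.2 - p.2 * q.1.

Section linear_change_of_variables.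
Local Open Scope ereal_scope.
Variable R : realType.
Let mu : {sigma_finite_measure set (measurableTypeR R) -> \bar R} :=
  @lebesgue_measure R.

Lemma measurable_lin (p q : R * R) : measurable_fun setT (lin p q).
Proof.
by apply: measurable_fun_pair; apply: measurable_funD => //;
  apply: measurable_funM => //.
Qed.

Lemma measurable_translation (t : R * R) : measurable_fun setT
  (fun w : R * R => w + t)%R.
Proof.
apply: (@measurable_fun_pair _ _ _ _ _ _ (fun w : R * R => w.1 + t.1)
  (fun w : R * R => w.2 + t.2))%R;
  by apply: measurable_funD => //.
Qed.

(** Tonelli splits this into two one-dimensional substitutions: the first parameter is exchanged for
    the first image coordinate, with slope [p.1], then the second parameter for the second image
    coordinate, with slope [cross p q / p.1]. *)
Let ge0_integral_lin_aux (F : R * R -> \bar R) (p q t : R * R) :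
  p.1 != 0%R -> cross p q != 0%R ->
  measurable_fun setT F -> (forall z, 0 <= F z) ->
  `|cross p q|%:E * \int[@area R]_w F (lin p q w + t)%R = \int[@area R]_z F z.
Proof.
move=> p0 d0 mF F0.
have mFlin : measurable_fun setT (fun w => F (lin p q w + t)%R).
  apply: (measurableT_comp mF).
  by apply: (measurableT_comp (measurable_translation t));
    exact: measurable_lin.
(* [k (x, b)] is the second image coordinate in terms of the first one, [x], and the second
   parameter [b]. *)
pose k (z : R * R) := (p.2 / p.1 * (z.1 - q.1 * z.2 - t.1) + q.2 * z.2 + t.2)%R.
have mk : measurable_fun setT k.
  by rewrite /k;
    do ?[apply: measurable_funB => // | apply: measurable_funD => // | apply:
      measurable_funM => //].
have mFk : measurable_fun setT (fun z : R * R => F (z.1, k z)).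
  by apply: (measurableT_comp mF);
    apply: (measurable_fun_pair measurable_fst mk).
rewrite [X in _ * X](fubini_tonelli2 (m1 := mu) (m2 := mu))//.
rewrite [RHS](fubini_tonelli1 (m1 := mu) (m2 := mu))//.
transitivity (`|cross p q / p.1|%:E * \int[mu]_b \int[mu]_x F (x, k (x, b))).
  rewrite normrM normfV EFinM -muleA; congr (_ * _).
  rewrite -ge0_integralZl//; last 2 first.
  - by apply: (measurable_fun_fubini_tonelli_G (m1 :=
    mu) (fun z : R * R => F (z.1, k z))).
  - by move=> b _; exact: integral_ge0.
  apply: eq_integral => b _.
  transitivity (\int[mu]_a F (p.1 * a + (q.1 * b + t.1),
    k (p.1 * a + (q.1 * b + t.1), b))%R).
    rewrite /fubini_G; apply: eq_integral => a _; congr F.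
    rewrite /lin /k /=; apply/pair_equal_spec; split => /=;
      first by rewrite addrA.
    by field.
  rewrite -(@ge0_integral_affine _ (fun x => F (x, k (x, b))) p.1
    (q.1 * b + t.1)%R)//.
    by rewrite muleA -EFinM mulVf ?normr_eq0// mul1e.
  apply: (measurable_fun_pair1 _ mFk).
rewrite -(fubini_tonelli (m1 := mu) (m2 :=
  mu) (fun z : R * R => F (z.1, k z)))//=.
rewrite -ge0_integralZl//; last 2 first.
- by apply: (measurable_fun_fubini_tonelli_F (m2 :=
  mu) (fun z : R * R => F (z.1, k z))).
- by move=> b _; exact: integral_ge0.
apply: eq_integral => x _; rewrite /fubini_F.
rewrite -(@ge0_integral_affine _ (fun y => F (x, y)) (cross p q / p.1)%R
  (p.2 / p.1 * (x - t.1) + t.2)%R)//; last 2 first.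
- by rewrite mulf_neq0 ?invr_eq0.
- exact: (measurable_fun_pair2 _ mF).
congr (_ * _); apply: eq_integral => b _; congr (F (_, _)).
by rewrite /k /cross /=; field.
Qed.

Lemma ge0_integral_lin (F : R * R -> \bar R) (p q t : R * R) :
  cross p q != 0%R -> measurable_fun setT F -> (forall z, 0 <= F z) ->
  `|cross p q|%:E * \int[@area R]_w F (lin p q w + t)%R = \int[@area R]_z F z.
Proof.
have [p0|p0] := eqVneq p.1 0%R; last exact: ge0_integral_lin_aux.
(* If [p.1] vanishes then [q.1] does not, and swapping [p] and [q] only swaps the order of
   integration. *)
move=> d0 mF F0.
have q0 : q.1 != 0%R.
  by apply: contraNneq d0 => q0; rewrite /cross p0 q0 mul0r mulr0 subrr.
have dE : cross p q = (- cross q p)%R by rewrite /cross; ring.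
rewrite dE normrN -[RHS](ge0_integral_lin_aux (p := q) (q := p) t)//;
  last first.
  by apply: contra_neq d0 => d0; rewrite dE d0 oppr0.
congr (_ * _).
have mFl : measurable_fun setT (fun w => F (lin q p w + t)%R).
  apply: (measurableT_comp mF).
  by apply: (measurableT_comp (measurable_translation t));
    exact: measurable_lin.
have mFl' : measurable_fun setT (fun w => F (lin p q w + t)%R).
  apply: (measurableT_comp mF).
  by apply: (measurableT_comp (measurable_translation t));
    exact: measurable_lin.
transitivity (\int[mu]_x \int[mu]_y F (lin p q (x, y) + t)%R).
  exact: (fubini_tonelli1 (m1 := mu) (m2 := mu) (fun w => F (lin p q w + t)%R)).
transitivity (\int[mu]_y \int[mu]_x F (lin q p (x, y) + t)%R); last first.
  by apply/esym;
    apply: (fubini_tonelli2 (m1 := mu) (m2 :=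
      mu) (fun w => F (lin q p w + t)%R)).
apply: eq_integral => x _; apply: eq_integral => y _; congr (F (_ + _)%R).
by rewrite /lin /= addrC [X in (_, X)]addrC.
Qed.

Lemma Rintegral_lin (F : R * R -> R) (p q t : R * R) :
  cross p q != 0%R -> (@area R).-integrable setT (EFin \o F) ->
  (\int[@area R]_z F z = `|cross p q| * \int[@area R]_w F (lin p q w + t))%R.
Proof.
move=> d0 iF.
have mF : measurable_fun setT F by apply/measurable_EFinP;
  exact: measurable_int iF.
have mFl : measurable_fun setT (fun w => F (lin p q w + t)%R).
  apply: (measurableT_comp mF).
  by apply: (measurableT_comp (measurable_translation t));
    exact: measurable_lin.
have iFl : (@area R).-integrable setT (EFin \o (fun w => F (lin p q w + t)%R)).
  apply/integrableP; split; first exact/measurable_EFinP.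
  have /integrableP[_] := iF.
  rewrite -(ge0_integral_lin (p := p) (q := q) t)//; last first.
    by do 2 apply: measurableT_comp => //.
  have Jgt0 : (0 < `|cross p q|)%R by rewrite normr_gt0.
  set I := (X in _ * X < _); set I' := (X in _ -> X < _).
  have -> : I' = I by [].
  case: I => [r| |]; rewrite ?ltry//.
  by rewrite gt0_muley ?lte_fin.
rewrite /Rintegral -[X in (X * _)%R]/(fine `|cross p q|%:E) -fineM//;
  last exact: integrable_fin_num.
congr fine; rewrite [in LHS]integralE [in RHS]integralE muleBr//; last first.
  by rewrite fin_num_adde_defl// fin_numN;
    exact: (integrable_neg_fin_num measurableT iFl).
rewrite -(ge0_integral_lin (F := (fun x => (F x)%:E)^\+) (p := p) (q :=
  q) t)//; last first.
  by apply: measurable_funepos; exact/measurable_EFinP.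
rewrite -(ge0_integral_lin (F := (fun x => (F x)%:E)^\-) (p := p) (q :=
  q) t)//; last first.
  by apply: measurable_funeneg; exact/measurable_EFinP.
by congr (_ * _ - _ * _); apply: eq_integral => x _;
  rewrite ?funeposE ?funenegE.
Qed.

End linear_change_of_variables.

(** * Hex-splines against test functions *)

Section bounded_support.
Context d (T : measurableType d) (R : realType) (m : {measure set T -> \bar R}).

Lemma integrable_bounded_support (f : T -> R) (A : set T) (C : R) :
  measurable A -> (m A < +oo)%E -> measurable_fun setT f ->
  (forall x, `|f x| <= C) -> (forall x, ~ A x -> f x = 0) ->
  m.-integrable setT (EFin \o f).
Proof.
move=> mA mAoo mf fC f0.
have iA : m.-integrable setT (EFin \o (fun x => C * \1_A x)).
  apply: (eq_integrable _ (fun x => C%:E * (\1_A x)%:E)%E) => //.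
  apply: integrableZl => //; apply/integrableP; split;
    first exact/measurable_EFinP.
  under eq_integral do rewrite gee0_abs ?lee_fin//.
  by rewrite integral_indic// setIT.
apply: (le_integrable _ _ _ iA) => //; first exact/measurable_EFinP.
move=> x _ /=; rewrite lee_fin indicE.
have [/set_mem xA|/negP xA] := boolP (x \in A).
  by rewrite mulr1 (le_trans (fC x))// ler_norm.
by rewrite f0 ?normr0// => /mem_set.
Qed.

End bounded_support.

Section Rfubini.
Context d1 d2 (T1 : measurableType d1) (T2 : measurableType d2) (R : realType).
Variable m1 : {sigma_finite_measure set T1 -> \bar R}.
Variable m2 : {sigma_finite_measure set T2 -> \bar R}.
Variables (h : T1 * T2 -> R) (A1 : set T1) (A2 : set T2) (C : R).
Hypotheses (mA1 : measurable A1) (mA2 : measurable A2).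
Hypotheses (A1oo : (m1 A1 < +oo)%E) (A2oo : (m2 A2 < +oo)%E).
Hypotheses (mh : measurable_fun setT h) (hC : forall z, `|h z| <= C).
Hypothesis h0 : forall z, ~ (A1 z.1 /\ A2 z.2) -> h z = 0.

Let ih : (m1 \x m2)%E.-integrable setT (EFin \o h).
Proof.
apply: (@integrable_bounded_support _ _ _ _ h (A1 `*` A2) C) => //.
  exact: measurableX.
by rewrite [X in (X < _)%E](@product_measure1E _ _ _ _ _ m1 m2)//
  lte_mul_pinfty// ge0_fin_numE.
Qed.

Let i1 x : m2.-integrable setT (EFin \o (fun y => h (x, y))).
Proof.
apply: (@integrable_bounded_support _ _ _ _ _ A2 C) => //.
  exact: (measurable_fun_pair2 _ mh).
by move=> y yA2; apply: h0 => -[].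
Qed.

Let i2 y : m1.-integrable setT (EFin \o (fun x => h (x, y))).
Proof.
apply: (@integrable_bounded_support _ _ _ _ _ A1 C) => //.
  exact: (measurable_fun_pair1 _ mh).
by move=> x xA1; apply: h0 => -[].
Qed.

Let E1 x : (\int[m2]_y h (x, y))%:E = (\int[m2]_y (h (x, y))%:E)%E.
Proof. by rewrite /Rintegral fineK//;
  exact: (integrable_fin_num measurableT (i1 x)). Qed.

Let E2 y : (\int[m1]_x h (x, y))%:E = (\int[m1]_x (h (x, y))%:E)%E.
Proof. by rewrite /Rintegral fineK//;
  exact: (integrable_fin_num measurableT (i2 y)). Qed.

Lemma Rintegral12 : \int[(m1 \x m2)%E]_z h z = \int[m1]_x \int[m2]_y h (x, y).
Proof.
rewrite [RHS]/Rintegral [LHS]/Rintegral; congr fine;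
  under [RHS]eq_integral do rewrite E1.
by rewrite -(integral12_prod_meas1 ih).
Qed.

Lemma Rfubini :
  \int[m1]_x \int[m2]_y h (x, y) = \int[m2]_y \int[m1]_x h (x, y).
Proof.
rewrite [RHS]/Rintegral [LHS]/Rintegral; congr fine;
  under [LHS]eq_integral do rewrite E1.
under [RHS]eq_integral do rewrite E2.
exact: (Fubini ih).
Qed.

Lemma measurable_Rintegral1 : measurable_fun setT
  (fun x => \int[m2]_y h (x, y)).
Proof.
apply/measurable_EFinP;
  apply: eq_measurable_fun (measurable_fubini_F ih) => x _ /=.
by rewrite E1.
Qed.

Lemma integrable_Rintegral1 :
  m1.-integrable setT (EFin \o (fun x => \int[m2]_y h (x, y))).
Proof.
apply: eq_integrable (integrable_fubini_F ih) => // x _ /=.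
by rewrite E1.
Qed.

End Rfubini.

Section tame.
Variable R : realType.
Implicit Types f g th : R * R -> R.
Let mu : {sigma_finite_measure set (measurableTypeR R) -> \bar R} :=
  @lebesgue_measure R.

Definition box (K : R) : set (R * R) := `[- K, K] `*` `[- K, K].

Lemma measurable_box K : measurable (box K).
Proof. by apply: measurableX. Qed.

Lemma area_box K : (area (box K) < +oo)%E.
Proof.
have muK : (mu `[(- K)%R, K]%classic < +oo)%E.
  by rewrite /mu /= lebesgue_measure_itv /=; case: ifP => // _;
    rewrite -EFinD ltry.
rewrite [X in (X < _)%E](@product_measure1E _ _ _ _ _ mu mu)// lte_mul_pinfty//.
by rewrite ge0_fin_numE.
Qed.

Lemma boxP K x : box K x <-> `|x.1| <= K /\ `|x.2| <= K.
Proof. by rewrite /box /= !in_itv /= -!ler_norml. Qed.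

Lemma boxD K K' x y : box K x -> box K' y -> box (K + K') (x + y).
Proof.
move=> /boxP[x1 x2] /boxP[y1 y2]; apply/boxP => /=.
by split; apply: le_trans (ler_normD _ _) _; exact: lerD.
Qed.

Lemma boxN K x : box K x -> box K (- x).
Proof. by move=> /boxP[x1 x2]; apply/boxP => /=; rewrite !normrN. Qed.

(** The working class of functions: it lies in L^1, allows Fubini, and is stable under translation,
    products, convolution and correlation. *)
Definition tame f :=
  [/\ measurable_fun setT f, exists C, forall x, `|f x| <= C &
      exists K, forall x, ~ box K x -> f x = 0].

Lemma tame_integrable f : tame f -> (@area R).-integrable setT (EFin \o f).
Proof.
move=> [mf [C fC] [K f0]].
apply: (@integrable_bounded_support _ _ _ (@area R) f (box K) C) => //.
- exact: measurable_box.
- exact: area_box.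
Qed.

Lemma measurable_subp d (T : measurableType d) (f g : T -> R * R) :
  measurable_fun setT f -> measurable_fun setT g ->
  measurable_fun setT (fun x => f x - g x).
Proof.
move=> mf mg.
apply: (@measurable_fun_pair _ _ _ _ _ _ (fun x => (f x).1 - (g x).1)
  (fun x => (f x).2 - (g x).2));
  apply: measurable_funB; exact: measurableT_comp.
Qed.

Lemma measurable_addp d (T : measurableType d) (f g : T -> R * R) :
  measurable_fun setT f -> measurable_fun setT g ->
  measurable_fun setT (fun x => f x + g x).
Proof.
move=> mf mg.
apply: (@measurable_fun_pair _ _ _ _ _ _ (fun x => (f x).1 + (g x).1)
  (fun x => (f x).2 + (g x).2));
  apply: measurable_funD; exact: measurableT_comp.
Qed.

Lemma tame_translate f t : tame f -> tame (fun x => f (x + t)).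
Proof.
move=> [mf [C fC] [K f0]]; split.
- exact: (measurableT_comp mf (measurable_translation t)).
- by exists C.
- exists (K + (`|t.1| + `|t.2|)) => x xK; apply: f0 => xtK; apply: xK.
  rewrite -[x](addrK t); apply: boxD => //; apply/boxN/boxP.
  by rewrite lerDl lerDr.
Qed.

Lemma tameM f g : tame f -> tame g -> tame (fun x => f x * g x).
Proof.
move=> [mf [C fC] [K f0]] [mg [D gD] [L g0]]; split.
- exact: measurable_funM.
- exists (C * D) => x; rewrite normrM; apply: ler_pM => //.
- by exists K => x xK; rewrite f0// mul0r.
Qed.

Lemma tameD f g : tame f -> tame g -> tame (fun x => f x + g x).
Proof.
move=> [mf [C fC] [K f0]] [mg [D gD] [L g0]]; split.
- exact: measurable_funD.
- exists (C + D) => x; apply: le_trans (ler_normD _ _) _; exact: lerD.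
- exists (Num.max K L) => x xK; rewrite f0 ?g0 ?addr0//;
    move=> /boxP[x1 x2]; apply: xK; apply/boxP; rewrite !le_max x1 x2 ?orbT//.
Qed.

Lemma tameZ k f : tame f -> tame (fun x => k * f x).
Proof.
move=> [mf [C fC] [K f0]]; split.
- exact: measurable_funM.
- by exists (`|k| * C) => x; rewrite normrM ler_wpM2l.
- by exists K => x xK; rewrite f0// mulr0.
Qed.

Lemma tame0 : tame (fun _ => 0).
Proof.
split => //; first by exists 0 => x; rewrite normr0.
by exists 0.
Qed.

Lemma Rintegral_translate f t : tame f ->
  \int[@area R]_x f (x + t) = \int[@area R]_x f x.
Proof.
move=> tf.
rewrite (@Rintegral_lin _ f (1, 0) (0, 1) t) /=; last exact: tame_integrable.
- rewrite /cross /= mulr1 mulr0 subr0 normr1 mul1r.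
  apply: eq_Rintegral => -[x y] _; rewrite /lin /=.
  by rewrite !mul1r !mul0r addr0 add0r.
- by rewrite /cross /= mulr1 mulr0 subr0 oner_eq0.
Qed.

Lemma RintegralD_tame f g : tame f -> tame g ->
  \int[@area R]_x (f x + g x) = \int[@area R]_x f x + \int[@area R]_x g x.
Proof. by move=> tf tg; rewrite RintegralD//; exact: tame_integrable. Qed.

Lemma RintegralZ_tame k f : tame f ->
  \int[@area R]_x (k * f x) = k * \int[@area R]_x f x.
Proof. by move=> tf; rewrite RintegralZl//; exact: tame_integrable. Qed.

Lemma normr_Rintegral_le f K C : measurable_fun setT f ->
  (forall x, `|f x| <= C) -> (forall x, ~ box K x -> f x = 0) ->
  `|\int[@area R]_x f x| <= C * fine (area (box K)).
Proof.
move=> mf fC f0.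
have tf : tame f by split => //; [exists C|exists K].
have C0 : 0 <= C by apply: le_trans (fC 0).
have tb : tame (\1_(box K)).
  split.
  - apply: measurable_indic; exact: measurable_box.
  - by exists 1 => x; rewrite indicE normr_nat lern1 leq_b1.
  - by exists K => x xK; rewrite indicE memNset.
apply: (le_trans (le_normr_Rintegral measurableT (tame_integrable tf))).
have -> : fine (area (box K)) = \int[@area R]_x \1_(box K) x.
  by rewrite /Rintegral integral_indic ?setIT//; exact: measurable_box.
rewrite -RintegralZ_tame//; apply: le_Rintegral => //.
- apply: (@tame_integrable (fun x => `|f x|)); split.
  + exact: measurableT_comp.
  + by exists C => x; rewrite normr_id.
  + by exists K => x xK; rewrite f0// normr0.
- exact/tame_integrable/tameZ.
- move=> x _; rewrite indicE; have [/set_mem xA|/negP xA] :=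
  boolP (x \in box K).
    by rewrite mulr1.
  by rewrite f0 ?normr0 ?mulr0// => /mem_set.
Qed.

End tame.

Definition correlation (R : realType) (V : set (R * R)) (th : R * R -> R) :
  R * R -> R := fun x => \int[@area R]_y (\1_V y * th (x + y)).

Section pairing.
Variables (R : realType) (V : set (R * R)) (K : R).
Hypotheses (mV : measurable V) (VK : V `<=` box K).

Let indicV x : ~ box K x -> \1_V x = 0 :> R.
Proof. by move=> xK; rewrite indicE memNset// => /VK. Qed.

Let indic_le1 x : `|\1_V x : R| <= 1.
Proof. by rewrite indicE normr_nat lern1 leq_b1. Qed.

Let m1V : measurable_fun setT (\1_V : R * R -> R).
Proof. exact: measurable_indic. Qed.

Lemma tame_indic : tame (\1_V).
Proof.
split; first exact: measurable_indic.
- by exists 1.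
- by exists K.
Qed.

Let measurable_convolution_kernel (f : R * R -> R) : measurable_fun setT f ->
  measurable_fun setT (fun z : (R * R) * (R * R) => \1_V z.2 * f (z.1 - z.2)).
Proof.
move=> mf; apply: measurable_funM.
  exact: (measurableT_comp m1V measurable_snd).
apply: (measurableT_comp mf); exact: measurable_subp.
Qed.

Let measurable_correlation_kernel (th : R * R -> R) : measurable_fun setT th ->
  measurable_fun setT (fun z : (R * R) * (R * R) => \1_V z.2 * th (z.1 + z.2)).
Proof.
move=> mf; apply: measurable_funM.
  exact: (measurableT_comp m1V measurable_snd).
apply: (measurableT_comp mf); exact: measurable_addp.
Qed.

(** Common core for convolution and correlation, where [h (x, y)] is [f (x - y)] or [th (x + y)]. *)
Let tame_kernel (h : (R * R) * (R * R) -> R) (C L : R) :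
  measurable_fun setT (fun z => \1_V z.2 * h z) ->
  (forall z, `|h z| <= C) ->
  (forall z, ~ box L z.1 -> box K z.2 -> h z = 0) ->
  tame (fun x => \int[@area R]_y (\1_V y * h (x, y))).
Proof.
move=> mh hC h0.
have C0 : 0 <= C by apply: le_trans (hC (0, 0)).
have kC x y : `|\1_V y * h (x, y)| <= C.
  by rewrite normrM -[leRHS]mul1r ler_pM.
split.
- apply: (@measurable_Rintegral1 _ _ _ _ _ (@area R) (@area R)
    (fun z => \1_V z.2 * h z) (box L) (box K) C) => //.
  + exact: measurable_box.
  + exact: measurable_box.
  + exact: area_box.
  + exact: area_box.
  + by move=> [].
  + move=> [x y] /= /not_andP xy; have [yK|yK] := pselect (box K y).
      by case: xy => // xL; rewrite h0 ?mulr0.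
    by rewrite indicV ?mul0r.
- exists (C * fine (area (box K))) => x; apply: normr_Rintegral_le => //.
    exact: (measurable_fun_pair2 _ mh).
  by move=> y yK; rewrite indicV ?mul0r.
- exists L => x xL; rewrite /Rintegral integral0_eq// => y _.
  have [yK|yK] := pselect (box K y); first by rewrite h0 ?mulr0.
  by rewrite indicV ?mul0r.
Qed.

Lemma tame_convolution f : tame f -> tame (convolution (\1_V) f).
Proof.
move=> [mf [C fC] [L f0]].
apply: (@tame_kernel (fun z => f (z.1 - z.2)) C (L + K)) => //.
  exact: measurable_convolution_kernel.
move=> [x y] /= xL yK; apply: f0 => xyL; apply: xL.
by rewrite -[x](subrK y); exact: boxD.
Qed.

Lemma tame_correlation th : tame th -> tame (correlation V th).
Proof.
move=> [mf [C fC] [L f0]].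
apply: (@tame_kernel (fun z => th (z.1 + z.2)) C (L + K)) => //.
  exact: measurable_correlation_kernel.
move=> [x y] /= xL yK; apply: f0 => xyL; apply: xL.
by rewrite -[x](addrK y); apply: boxD => //; exact: boxN.
Qed.

(** Fubini, the substitution of [x + y] for [x] in the inner integral, and Fubini back; the boxes
    and bounds from tameness justify both exchanges. *)
Lemma convolution_correlation f th l : tame f -> tame th ->
  \int[@area R]_x (convolution (\1_V) f (x - l) * th x) =
  \int[@area R]_x (f (x - l) * correlation V th x).
Proof.
move=> tf tth.
have tfl : tame (fun x => f (x - l)) := tame_translate (- l) tf.
have [mfl [C fC] [L fl0]] := tfl.
have [mth [D thD] [M th0]] := tth.
have C0 : 0 <= C by apply: le_trans (fC 0).
have D0 : 0 <= D by apply: le_trans (thD 0).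
have tind := tame_indic.
transitivity (\int[@area R]_x \int[@area R]_y (\1_V y * f (x - l - y) * th x)).
  apply: eq_Rintegral => x _.
  rewrite /convolution mulrC -RintegralZ_tame; last first.
    apply: tameM => //.
    rewrite (_ : (fun _ => _) = fun y => (f \o -%R) (y + (l - x))); last first.
      by apply/funext => y; rewrite /= opprD opprB addrC.
    apply: tame_translate; have [mf [C' fC'] [L' f0]] := tf; split.
    - apply: (measurableT_comp mf).
      rewrite (_ : -%R = fun x : R * R => 0 - x); last by apply/funext => z;
        rewrite sub0r.
      exact: measurable_subp.
    - by exists C' => z /=.
    - by exists L' => z zL /=; apply: f0 => zL'; apply: zL; rewrite -[z]opprK;
      exact: boxN.
  by apply: eq_Rintegral => y _; rewrite mulrC.
transitivity (\int[@area R]_y \int[@area R]_x (\1_V y * f (x - l - y) * th x)).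
  apply: (@Rfubini _ _ _ _ _ (@area R) (@area R)
    (fun z => \1_V z.2 * f (z.1 - l - z.2) * th z.1) (box M) (box K)
      (C * D)) => //.
  + exact: measurable_box.
  + exact: measurable_box.
  + exact: area_box.
  + exact: area_box.
  + apply: measurable_funM; last exact: (measurableT_comp mth).
    rewrite (_ :
      (fun z => _) = (fun z : (R * R) * (R * R) => \1_V z.2 *
        (fun x => f (x - l)) (z.1 - z.2))).
      exact: measurable_convolution_kernel mfl.
    by apply/funext => z; rewrite addrAC.
  + move=> [x y] /=; rewrite normrM ler_pM// normrM -[leRHS]mul1r ler_pM//.
    by rewrite addrAC.
  + move=> [x y] /= /not_andP[xM|yK]; first by rewrite th0 ?mulr0.
    by rewrite indicV ?mul0r.
transitivity (\int[@area R]_y \int[@area R]_x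
  (\1_V y * f (x - l) * th (x + y))).
  apply: eq_Rintegral => y _.
  rewrite -[LHS](Rintegral_translate y); last first.
    apply: (@tameM _ (fun x => \1_V y * f (x - l - y)) th) => //.
    apply: (@tameZ _ (\1_V y) (fun x => f (x - l - y))).
    under eq_fun do rewrite addrAC.
    exact: (tame_translate (- y) tfl).
  apply: eq_Rintegral => x _; congr (_ * f _ * _).
  by rewrite addrAC addrK.
rewrite -(@Rfubini _ _ _ _ _ (@area R) (@area R)
    (fun z => \1_V z.2 * f (z.1 - l) * th (z.1 + z.2)) (box L) (box K)
      (C * D)) => //.
- apply: eq_Rintegral => x _; rewrite /correlation -RintegralZ_tame; last first.
    apply: tameM => //.
    by under eq_fun do rewrite addrC; exact: tame_translate.
  by apply: eq_Rintegral => y _; rewrite mulrA [f _ * _]mulrC.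
- exact: measurable_box.
- exact: measurable_box.
- exact: area_box.
- exact: area_box.
- rewrite (_ :
  (fun z => _) = (fun z : (R * R) * (R * R) => (\1_V z.2 * th (z.1 + z.2)) * f
    (z.1 - l))).
    apply: measurable_funM; first exact: measurable_correlation_kernel mth.
    exact: (measurableT_comp mfl).
  by apply/funext => z; rewrite mulrAC.
- move=> [x y] /=; rewrite normrM ler_pM// normrM -[leRHS]mul1r ler_pM//.
- move=> [x y] /= /not_andP[xM|yK]; first by rewrite fl0 ?mulr0 ?mul0r.
  by rewrite indicV ?mul0r.
Qed.

Lemma tame_iter_convolution n : tame (iter n (convolution (\1_V)) (\1_V)).
Proof. by elim: n => [|n IHn]; [exact: tame_indic|exact: tame_convolution]. Qed.

(* The adjoint of convolution by [\1_V] is correlation with [\1_V]. *)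
Lemma iter_convolution_correlation n th l : tame th ->
  \int[@area R]_x (iter n (convolution (\1_V)) (\1_V) (x - l) * th x) =
  iter n.+1 (correlation V) th l.
Proof.
elim: n th => [|n IHn] th tth.
  rewrite /= /correlation -[RHS](Rintegral_translate (- l)); last first.
    apply: tameM; first exact: tame_indic.
    by under eq_fun do rewrite addrC; exact: tame_translate.
  by apply: eq_Rintegral => x _; rewrite [l + _]addrC subrK.
rewrite (iterSr n.+1 (correlation V)) -IHn; last exact: tame_correlation.
exact: (convolution_correlation l (tame_iter_convolution n) tth).
Qed.

End pairing.

(** * Correlation with a hexagon *)

Section FTC.
Variable R : realType.
Local Notation mu := (@lebesgue_measure R).

Lemma is_derive_continuous (f df : R -> R) :
  (forall x : R, is_derive x 1 f (df x)) -> continuous f.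
Proof.
move=> fdf x; apply/differentiable_continuous/derivable1_diffP.
by have [] := fdf x.
Qed.

Lemma is_derive_mul (f g : R -> R) (x a b : R) :
  is_derive x 1 f a -> is_derive x 1 g b ->
  is_derive x 1 (fun x => f x * g x) (f x * b + a * g x).
Proof. by move=> fa gb; have := is_deriveM fa gb; rewrite [a * _]mulrC. Qed.

Lemma is_derive_add (f g : R -> R) (x a b : R) :
  is_derive x 1 f a -> is_derive x 1 g b ->
  is_derive x 1 (fun x => f x + g x) (a + b).
Proof. exact: is_deriveD. Qed.

Lemma is_derive_mull (f : R -> R) (x a k : R) :
  is_derive x 1 f a -> is_derive x 1 (fun x => k * f x) (k * a).
Proof. exact: is_deriveZ. Qed.

Lemma is_derive_mulr (f : R -> R) (x a k : R) :
  is_derive x 1 f a -> is_derive x 1 (fun x => f x * k) (a * k).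
Proof.
by move=> fa; under eq_fun do rewrite mulrC; rewrite mulrC;
  exact: is_derive_mull.
Qed.

Lemma is_derive_sub (f g : R -> R) (x a b : R) :
  is_derive x 1 f a -> is_derive x 1 g b ->
  is_derive x 1 (fun x => f x - g x) (a - b).
Proof. exact: is_deriveB. Qed.

Lemma Rintegral_is_derive (F f : R -> R) (a b : R) : a < b ->
  (forall x : R, is_derive x 1 F (f x)) -> continuous f ->
  \int[mu]_(x in `[a, b]) f x = F b - F a.
Proof.
move=> ab Ff cf.
have cF := is_derive_continuous Ff.
rewrite /Rintegral (continuous_FTC2 (F := F) ab)//.
- exact: continuous_subspaceT.
- split=> [x _| |]; first by have [] := Ff x.
  + by apply: cvg_at_right_filter; exact: cF.
  + by apply: cvg_at_left_filter; exact: cF.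
- by move=> x _; rewrite derive1E; have [_] := Ff x.
Qed.

Lemma is_derive_translate (F f : R -> R) (c : R) :
  (forall x : R, is_derive x 1 F (f x)) ->
  forall x : R, is_derive x 1 (fun x => F (x + c)) (f (x + c)).
Proof.
move=> Ff x.
have := @is_derive1_comp _ F (shift c) x _ _ (Ff (shift c x))
  (is_derive_shift x 1 c).
by rewrite mulr1.
Qed.

End FTC.

(* A regular hexagon of circumradius proportional to [r], in the coordinates
   given by two vertices at angle 2 pi / 3. *)
Definition hexagon (R : realType) (r : R) : set (R * R) :=
  [set w | [/\ `|w.1| <= r, `|w.2| <= r & `|w.1 - w.2| <= r]].

Section hexagon_integral.
Variable R : realType.
Let mu : {sigma_finite_measure set (measurableTypeR R) -> \bar R} :=
  @lebesgue_measure R.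

Lemma measurable_hexagon (r : R) : measurable (hexagon r).
Proof.
have pre (f : R * R -> R) : measurable_fun setT f ->
    measurable [set w | `|f w| <= r].
  move=> mf; have -> : [set w | `|f w| <= r] = setT `&` f @^-1` `[- r, r].
    by rewrite setTI; apply/seteqP; split => w /=; rewrite in_itv /= ler_norml.
  exact: mf.
have -> : hexagon r = [set w | `|w.1| <= r] `&` ([set w | `|w.2| <= r] `&`
    [set w | `|w.1 - w.2| <= r]).
  by apply/seteqP; split => w /= => [[? ? ?]|[? [? ?]]].
apply: measurableI; [|apply: measurableI]; apply: pre => //.
exact: measurable_funB.
Qed.

Lemma hexagon_box (r : R) : hexagon r `<=` box r.
Proof. by move=> w [w1 w2 _]; apply/boxP. Qed.

Variables (f0 f1 f2 g0 g1 g2 : R -> R).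
Hypotheses (df0 : forall x : R, is_derive x 1 f0 (f1 x))
  (df1 : forall x : R, is_derive x 1 f1 (f2 x)) (cf2 : continuous f2)
  (dg0 : forall x : R, is_derive x 1 g0 (g1 x))
  (dg1 : forall x : R, is_derive x 1 g1 (g2 x)) (cg2 : continuous g2).
Variable C : R.
Hypotheses (f1C : forall x, `|f1 x| <= C) (f2C : forall x, `|f2 x| <= C)
  (g1C : forall x, `|g1 x| <= C) (g2C : forall x, `|g2 x| <= C).

Let cf0 := is_derive_continuous df0.
Let cf1 := is_derive_continuous df1.
Let cg0 := is_derive_continuous dg0.
Let cg1 := is_derive_continuous dg1.

Let section_integral (a : R) (W U : R) : W < U ->
  \int[mu]_(b in `[W, U]) (f2 a * g1 b + f1 a * g2 b) =
  f2 a * (g0 U - g0 W) + f1 a * (g1 U - g1 W).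
Proof.
move=> WU.
rewrite (@Rintegral_is_derive _ (fun b => f2 a * g0 b + f1 a * g1 b))//;
  first by ring.
- move=> x; apply: cvgD; apply: cvgM;
  [exact: cvg_cst|exact: cg1|exact: cvg_cst|exact: cg2].
Qed.

(** The integrand is d_1 d_2 (d_1 + d_2) of the product f0(a) g0(b). Integrating along [b] and then
    along [a] leaves first derivatives at the vertices: both of them at +-(r, r), d_1 at (+-r, 0)
    and d_2 at (0, +-r). *)
Lemma hexagon_integral (r : R) : 0 < r ->
  \int[@area R]_w (\1_(hexagon r) w * (f2 w.1 * g1 w.2 + f1 w.1 * g2 w.2)) =
  (f1 r * g0 r + f0 r * g1 r) + (f1 (- r) * g0 (- r) + f0 (- r) * g1 (- r))
  - f1 r * g0 0 - f1 (- r) * g0 0 - f0 0 * g1 r - f0 0 * g1 (- r).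
Proof.
move=> r0.
have C0 : 0 <= C by apply: le_trans (f1C 0).
pose h (w : R * R) := \1_(hexagon r) w * (f2 w.1 * g1 w.2 + f1 w.1 * g2 w.2).
pose H a := \int[mu]_b h (a, b).
have mcomp (f : R -> R) (p : R * R -> R) : continuous f -> measurable_fun setT
  p ->
    measurable_fun setT (fun w => f (p w)).
  by move=> cf mp; apply: (measurableT_comp (continuous_measurable_fun cf) mp).
have mh : measurable_fun setT h.
  apply: measurable_funM; first by apply: measurable_indic;
    exact: measurable_hexagon.
  by apply: measurable_funD; apply: measurable_funM; exact: mcomp.
have hC w : `|h w| <= 1 * (C * C + C * C).
  rewrite normrM ler_pM//; first by rewrite indicE normr_nat lern1 leq_b1.
  by apply: le_trans (ler_normD _ _) _; rewrite !normrM lerD// ler_pM.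
have h0 w : ~ (`[- r, r]%classic w.1 /\ `[- r, r]%classic w.2) -> h w = 0.
  move=> wr; rewrite /h indicE memNset ?mul0r// => /hexagon_box wb; exact: wr.
have mI : measurable `[- r, r]%classic by [].
have Ioo : (mu `[(- r)%R, r]%classic < +oo)%E.
  by rewrite /mu /= lebesgue_measure_itv /=; case: ifP => // _;
    rewrite -EFinD ltry.
transitivity (\int[mu]_a H a).
  exact: (@Rintegral12 _ _ _ _ _ mu mu h _ _ _ mI mI Ioo Ioo mh hC h0).
have Hr a : ~ `[- r, r]%classic a -> H a = 0.
  by move=> ar; rewrite /H /Rintegral integral0_eq// => b _;
    rewrite h0// => -[].
have HE a W U : W < U ->
   (forall b, hexagon r (a, b) <-> b \in `[W, U]) ->
   H a = f2 a * (g0 U - g0 W) + f1 a * (g1 U - g1 W).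
  move=> WU hexE; rewrite -section_integral// Rintegral_mkcond.
  apply: eq_Rintegral => b _; rewrite /h patchE indicE /=.
  have [bWU|bWU] := boolP (b \in `[W, U]).
    by rewrite !mem_set ?mul1r//; exact/hexE.
  by rewrite !memNset ?mul0r//; [exact/negP|move/hexE; exact/negP].
(* The vertical slice of the hexagon is [a - r, r] for a >= 0 and [- r, a + r] for a <= 0. *)
have H1 a : 0 <= a <= r ->
    H a = f2 a * (g0 r - g0 (a + - r)) + f1 a * (g1 r - g1 (a + - r)).
  move=> /andP[a0 ar]; apply: HE; first by lra.
  move=> b; rewrite /hexagon /= in_itv /= !ler_norml; split.
    by move=> [? ? ?]; lra.
  by move=> ?; split; lra.
have H2 a : - r <= a <= 0 ->
    H a = f2 a * (g0 (a + r) - g0 (- r)) + f1 a * (g1 (a + r) - g1 (- r)).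
  move=> /andP[a0 ar]; apply: HE; first by lra.
  move=> b; rewrite /hexagon /= in_itv /= !ler_norml; split.
    by move=> [? ? ?]; lra.
  by move=> ?; split; lra.
have ct (f : R -> R) c : continuous f -> continuous (fun x => f (x + c)).
  move=> cf x; apply: (@continuous_comp _ _ _ (fun x => x + c)); last exact: cf.
  by apply: cvgD; [exact: cvg_id|exact: cvg_cst].
have dg0' c := is_derive_translate c dg0.
have I1 : \int[mu]_(a in `[0, r]) H a =
   (f1 r * g0 r + f0 r * g1 r - f1 r * g0 0) - (f1 0 * g0 r + f0 0 * g1 r - f1
     0 * g0 (- r)).
  transitivity (\int[mu]_(a in `[0, r]) (f2 a * (g0 r - g0 (a + - r)) + f1 a *
    (g1 r - g1 (a + - r)))).
    by apply: eq_Rintegral => a; rewrite inE /= in_itv /=; exact: H1.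
  (* The two terms at the moving end point combine into one derivative by the product rule. *)
  have D (x : R) : is_derive x 1
    (fun a => f1 a * g0 r + f0 a * g1 r - f1 a * g0 (a + - r))
      (f2 x * (g0 r - g0 (x + - r)) + f1 x * (g1 r - g1 (x + - r))).
    rewrite (_ : _ + _ = f2 x * g0 r + f1 x * g1 r -
        (f1 x * g1 (x + - r) + f2 x * g0 (x + - r))); last by ring.
    exact: (is_derive_sub
      (is_derive_add (is_derive_mulr _ (df1 x)) (is_derive_mulr _ (df0 x)))
      (is_derive_mul (df1 x) (dg0' _ x))).
  rewrite (Rintegral_is_derive r0 D); first by rewrite subrr add0r.
  move=> x; apply: cvgD; apply: cvgM; [exact: cf2| |exact: cf1|];
    apply: cvgB; first [exact: cvg_cst|exact: ct].
have I2 : \int[mu]_(a in `[- r, 0]) H a =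
   (f1 0 * g0 r - f1 0 * g0 (- r) - f0 0 * g1 (- r)) -
   (f1 (- r) * g0 0 - f1 (- r) * g0 (- r) - f0 (- r) * g1 (- r)).
  transitivity (\int[mu]_(a in `[- r, 0]) (f2 a * (g0 (a + r) - g0 (- r)) + f1
    a * (g1 (a + r) - g1 (- r)))).
    by apply: eq_Rintegral => a; rewrite inE /= in_itv /=; exact: H2.
  have D (x : R) : is_derive x 1
    (fun a => f1 a * g0 (a + r) - f1 a * g0 (- r) - f0 a * g1 (- r))
      (f2 x * (g0 (x + r) - g0 (- r)) + f1 x * (g1 (x + r) - g1 (- r))).
    rewrite (_ : _ + _ = f1 x * g1 (x + r) + f2 x * g0 (x + r) -
        f2 x * g0 (- r) - f1 x * g1 (- r)); last by ring.
    exact: (is_derive_sub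
      (is_derive_sub (is_derive_mul (df1 x) (dg0' _ x))
        (is_derive_mulr _ (df1 x)))
      (is_derive_mulr _ (df0 x))).
  have Nr0 : - r < 0 by rewrite oppr_lt0.
  rewrite (Rintegral_is_derive Nr0 D); first by rewrite addNr add0r.
  move=> x; apply: cvgD; apply: cvgM; [exact: cf2| |exact: cf1|];
    apply: cvgB; first [exact: cvg_cst|exact: ct].
have iH : mu.-integrable setT (EFin \o H).
  exact: (@integrable_Rintegral1 _ _ _ _ _ mu mu h _ _ _ mI mI Ioo Ioo mh hC
    h0).
have -> : \int[mu]_a H a = \int[mu]_(a in `[- r, r]) H a.
  rewrite [RHS]Rintegral_mkcond; apply: eq_Rintegral => a _; rewrite patchE.
  by case: ifPn => // /negP ar; apply: Hr => /mem_set.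
have -> : `[- r, r]%classic = `[- r, 0]%classic `|` `]0, r]%classic.
  apply/seteqP; split => a /=; rewrite !in_itv /=;
    first by case: (leP a 0) => ? ?; [left|right]; lra.
  by case; lra.
rewrite Rintegral_setU//.
- rewrite Rintegral_itv_obnd_cbnd; last exact: integrableS iH.
  (* At a = 0 the terms with [f1 0] from the two halves cancel; those with [f0 0] are the
     contributions of the vertices (0, +-r). *)
  by rewrite I1 I2; ring.
- by apply: integrableS iH => //; exact: measurableU.
- rewrite disj_set2E; apply/eqP; rewrite -subset0 => a /= [];
  rewrite !in_itv /=; lra.
Qed.

End hexagon_integral.

(** * Bump functions *)

Section bump.
Variable R : realType.

(** For [posp ^+ 2] such a bound holds across the kink at 0, which replaces a discussion of
    one-sided derivatives. *)
Lemma is_derive_quadratic_remainder (f : R -> R) (x l M : R) :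
  (forall h, `|f (h + x) - f x - l * h| <= M * h ^+ 2) -> is_derive x 1 f l.
Proof.
move=> fM.
have cv : h^-1 *: (f (h *: 1 + x) - f x) @[h --> 0^'] --> l.
  have M0 : 0 <= M.
    by apply: le_trans (normr_ge0 _) (le_trans (fM 1) _); rewrite expr1n mulr1.
  apply/cvgrPdist_le => e e0.
  near=> h.
  have h0 : h != 0 by near: h; exact: nbhs_dnbhs_neq.
  have heM : `|h| <= e / (M + 1).
    near: h; apply: dnbhs0_le; rewrite divr_gt0//; lra.
  rewrite -[l](mulfK h0) mulrC -mulrBr normrM normfV.
  rewrite ler_pdivrMl ?normr_gt0// distrC [_ *: 1]mulr1.
  apply: le_trans (fM h) _.
  rewrite -(real_normK (num_real h)) expr2 mulrA [leRHS]mulrC ler_wpM2r//.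
  apply: (@le_trans _ _ ((M + 1) * `|h|)); first by rewrite ler_wpM2r// lerDl.
  by rewrite mulrC -ler_pdivlMr//; lra.
apply: DeriveDef; first by apply/cvg_ex; exists l.
exact/cvg_lim.
Unshelve. all: end_near. Qed.

Definition posp (x : R) : R := Num.max x 0.

Lemma pospM x : x * posp x = posp x ^+ 2.
Proof. by rewrite /posp; case: leP => x0; rewrite ?mulr0 ?expr0n// expr2. Qed.

Lemma is_derive_posp2 (x : R) : is_derive x 1 (fun x => posp x ^+ 2)
  (2 * posp x).
Proof.
apply: (@is_derive_quadratic_remainder _ _ _ 1) => h.
by rewrite mul1r /posp; case: (leP (h + x)) => hx; case: (leP x) => x0;
  rewrite ler_norml; apply/andP; split; nra.
Qed.

(** Reduces the derivatives of higher powers to those of a polynomial and of [posp ^+ 2]. *)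
Lemma posp_exp k x : posp x ^+ k.+2 = x ^+ k * posp x ^+ 2.
Proof.
elim: k => [|k IHk]; first by rewrite expr0 mul1r.
rewrite exprSr IHk [in RHS]exprSr -!mulrA; congr (_ * _).
by rewrite [in RHS]expr2 [RHS]mulrA pospM expr2 mulrA.
Qed.

Lemma is_derive_posp_exp k (x : R) :
  is_derive x 1 (fun x => posp x ^+ k.+2) (k.+2%:R * posp x ^+ k.+1).
Proof.
under eq_fun do rewrite posp_exp.
have E : forall z : R, z ^+ k = ('X^k).[z] by move=> z; rewrite hornerXn.
under eq_fun do rewrite E.
have := is_derive_mul (is_derive_poly 'X^k x) (is_derive_posp2 x).
rewrite derivXn hornerMn !hornerXn.
rewrite (_ : _ + _ = k.+2%:R * posp x ^+ k.+1)//.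
case: k {E} => [|k].
  by rewrite mulr0n mul0r addr0 expr0 mul1r expr1.
rewrite (posp_exp k) -pred_Sn -[x ^+ k *+ _]mulr_natl (_ :
  x ^+ k.+1 * _ = 2 * x ^+ k * (x * posp x)).
  by rewrite pospM -[k.+3]addn2 natrD; ring.
by rewrite exprS; ring.
Qed.

Variables (d : R) (n : nat) (r : {poly R}).
Hypothesis d0 : 0 < d.

Let q : {poly R} := (d ^+ 2)%:P - 'X^2.

(* [bump 0] is [(d^2 - x^2)_+^(n+1) r(x)] and [bump i] its [i]-th derivative,
   from which [(d^2 - x^2)_+^(n+1-i)] is factored out. *)
Fixpoint bump_coef (i : nat) : {poly R} :=
  if i is i'.+1 then (n.+1 - i')%:R *: (q^`() * bump_coef i') + q *
    (bump_coef i')^`()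
  else r.

Definition bump (i : nat) (x : R) : R :=
  posp (d ^+ 2 - x ^+ 2) ^+ (n.+1 - i) * (bump_coef i).[x].

Let hornerq x : q.[x] = d ^+ 2 - x ^+ 2.
Proof. by rewrite /q hornerD hornerN hornerC hornerXn. Qed.

Lemma is_derive_bump i (x : R) : (i < n)%N -> is_derive x 1 (bump i : R -> R)
  (bump i.+1 x).
Proof.
move=> ilt; rewrite /bump.
have [k kE] : exists k, (n.+1 - i)%N = k.+2 by exists (n - i.+1)%N; lia.
have kE' : (n.+1 - i.+1)%N = k.+1 by lia.
rewrite /= kE kE'.
have dq : is_derive x 1 (fun x : R => d ^+ 2 - x ^+ 2) q^`().[x].
  by under eq_fun do rewrite -hornerq; exact: is_derive_poly.
have := is_derive_mul (@is_derive1_comp _ (fun y => posp y ^+ k.+2)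
  (fun y : R => d ^+ 2 - y ^+ 2) x _ _
     (is_derive_posp_exp k (d ^+ 2 - x ^+ 2)) dq)
   (is_derive_poly (bump_coef i) x).
rewrite /= hornerD hornerZ !hornerM hornerq.
set P := posp _.
rewrite (_ : _ + _ = P ^+ k.+1 * (k.+2%:R * (q^`().[x] * (bump_coef i).[x]) +
  (d ^+ 2 - x ^+ 2) * (bump_coef i)^`().[x]))//.
rewrite mulrDr [X in _ = _ + X]mulrA.
have -> : P ^+ k.+1 * (d ^+ 2 - x ^+ 2) = P ^+ k.+2.
  by rewrite [in LHS]exprSr -mulrA [P * _]mulrC pospM -exprD addn2.
rewrite addrC; congr (_ + _); ring.
Qed.

Lemma bump_out i x : (i <= n)%N -> d <= `|x| -> bump i x = 0.
Proof.
move=> ilen dx; rewrite /bump (_ : posp _ = 0);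
  first by rewrite subSn// expr0n mul0r.
rewrite /posp; apply/max_idPr;
  rewrite subr_le0 -[leRHS](real_normK (num_real x)).
by rewrite ler_sqr ?nnegrE// ltW.
Qed.

Lemma bump_bounded i : (i <= n)%N -> exists C, forall x, `|bump i x| <= C.
Proof.
move=> ilen; have [C HC] :=
  poly_itv_bound (q ^+ (n.+1 - i) * bump_coef i) (- d) d.
have C0 : 0 <= C by apply: le_trans (HC 0 _); rewrite // oppr_le0 ltW.
exists C => x; have [dx|xd] := leP d `|x|; first by rewrite bump_out// normr0.
have /andP[x1 x2] : - d <= x <= d by rewrite -ler_norml ltW.
have -> : bump i x = (q ^+ (n.+1 - i) * bump_coef i).[x].
  rewrite hornerM horner_exp hornerq /bump (_ : posp _ = d ^+ 2 - x ^+ 2)//.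
  apply/max_idPl; rewrite subr_ge0 -(real_normK (num_real x)).
  by rewrite ler_sqr ?nnegrE// ltW.
by apply: HC; rewrite x1 x2.
Qed.

(** At 0 the positive part equals [q], so the jet is the one of the polynomial [q ^+ n.+1 * r] and
    can be prescribed through its coefficients. *)
Lemma bump_jet i : (i <= n)%N ->
  bump i 0 = ((q ^+ n.+1 * r)`_i *+ i`!).
Proof.
have derivE k : (k <= n.+1)%N -> q ^+ (n.+1 - k) * bump_coef k =
  (q ^+ n.+1 * r)^`(k).
  elim: k => [|k IHk] kn; first by rewrite subn0 derivn0.
  rewrite derivnS -IHk; last exact: ltnW.
  rewrite derivM deriv_exp (_ : n.+1 - k = (n.+1 - k.+1).+1)%N; last by lia.
  rewrite /= (_ : n.+1 - k = (n.+1 - k.+1).+1)%N; last by lia.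
  by rewrite exprS scaler_nat mulrDr mulrnAl mulrnAr; congr (_ *+ _ + _); ring.
move=> ilen; rewrite /bump expr0n /= subr0.
have -> : posp (d ^+ 2) = q.[0] by rewrite hornerq expr0n subr0 /posp;
  apply/max_idPl; rewrite sqr_ge0.
rewrite -horner_exp -hornerM derivE; last exact: ltnW.
by rewrite horner_coef0 coef_derivn addn0 ffactnn.
Qed.

End bump.

(** [al i] is the i-th derivative of [al 0] for i < n only. At higher indices it is just some
    continuous bounded function with the same support, so finite smoothness suffices. *)
Definition bump_family (R : realType) (d : R) (n : nat) (al : nat -> R -> R) :=
  [/\ forall i (x : R), (i.+1 < n)%N -> is_derive x 1 (al i) (al i.+1 x),
      forall i, continuous (al i),
      forall i x, d <= `|x| -> al i x = 0 &
      forall i, exists C, forall x, `|al i x| <= C].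

(** [be] is the profile in the flat direction; [al] has a nonzero derivative of the order [m] that
    survives. The factor [s] completes [q] to d^(2m+2) - X^(2m+2), so a power of [q * s] has no
    coefficient in degrees 1 to m. *)
Lemma bump_families_exist (R : realType) (d : R) (m n : nat) :
  0 < d -> (m < n)%N ->
  exists al be : nat -> R -> R,
    [/\ bump_family d n al, bump_family d n be, al m 0 != 0, be 0%N 0 != 0 &
        forall j, (0 < j <= m)%N -> be j 0 = 0].
Proof.
move=> d0 mn'; have mn := ltnW mn'.
(* The zero default makes continuity, support and boundedness hold at every index. *)
pose trunc r i : R -> R := if (i < n)%N then bump d n r i else (fun=> 0).
have fam r : bump_family d n (trunc r).
  split; rewrite /trunc.
  - by move=> i x iltn; rewrite iltn (ltnW iltn); exact/is_derive_bump/ltnW.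
  - move=> i; case: ifP => iltn; last by move=> x; exact: cvg_cst.
    by apply: (@is_derive_continuous _ _ (bump d n r i.+1)) => x;
      exact: is_derive_bump.
  - by move=> i x dx; case: ifP => // /ltnW iltn; exact: bump_out.
  - move=> i; case: ifP => [/ltnW|_]; first exact: bump_bounded.
    by exists 0 => x; rewrite normr0.
set q : {poly R} := (d ^+ 2)%:P - 'X^2.
(* The cofactor in the factorization of a difference of (m+1)-st powers, in the shape of
   [subrXX]. *)
pose s : {poly R} := \sum_(i < m.+1) (d ^+ 2)%:P ^+ (m.+1.-1 - i) * 'X^2 ^+ i.
have qs : q ^+ n.+1 * s ^+ n.+1 =
    ((((d ^+ 2) ^+ m.+1)%:P - 'X) ^+ n.+1) \Po 'X^(m.+1.*2).
  rewrite -exprMn -subrXX [RHS]rmorphXn /= comp_polyB comp_polyC comp_polyX.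
  by rewrite !polyC_exp -!exprM mul2n.
have coefqs i : (i <= m)%N -> (q ^+ n.+1 * s ^+ n.+1)`_i =
    (if i == 0%N then ((d ^+ 2) ^+ m.+1) ^+ n.+1 else 0).
  move=> im; rewrite qs coef_comp_poly_Xn//; case: eqP => [->|/eqP i0].
    rewrite dvdn0 div0n -horner_coef0 horner_exp hornerD hornerN hornerX
      hornerC.
    by rewrite subr0.
  by rewrite gtnNdvd ?lt0n//; lia.
have c0 : ((d ^+ 2) ^+ m.+1) ^+ n.+1 != 0 by rewrite !expf_neq0// gt_eqF.
exists (trunc ('X^m * s ^+ n.+1)), (trunc (s ^+ n.+1)); split => //;
  rewrite /trunc.
- rewrite mn' bump_jet// -/q mulrCA coefXnM ltnn subnn coefqs//= mulrn_eq0
  negb_or c0.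
  by rewrite -lt0n fact_gt0.
- by rewrite (leq_ltn_trans _ mn')// bump_jet// -/q coefqs//= mulrn_eq0
  negb_or c0.
- move=> j /andP[j0 jm];
  rewrite (leq_ltn_trans jm mn') bump_jet ?(leq_trans jm)// -/q coefqs//.
  by rewrite gtn_eqF// mul0rn.
Qed.

(** * Difference operators *)

Section difference_operators.
Variable R : realType.

(* [F i j] stands for the derivative of order [(i, j)] of a function, and the
   entry [(c, (a, b), t)] of a stencil for [c] times the derivative of order
   [(a, b)] translated by [t]. *)
Definition deriv_family := nat -> nat -> R * R -> R.

Definition stencil := seq (R * (nat * nat) * (R * R)).

Definition apply_stencil (l : stencil) (F : deriv_family) : deriv_family :=
  fun i j z =>
  \sum_(e <- l) e.1.1 * F (i + e.1.2.1)%N (j + e.1.2.2)%N (z + e.2).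

Lemma apply_stencilC l1 l2 F :
  apply_stencil l1 (apply_stencil l2 F) = apply_stencil l2 (apply_stencil l1 F).
Proof.
apply/funext => i; apply/funext => j; apply/funext => z; rewrite /apply_stencil.
under eq_bigr do rewrite big_distrr.
under [RHS]eq_bigr do rewrite big_distrr.
rewrite exchange_big; apply: eq_bigr => e2 _; apply: eq_bigr => e1 _ /=.
by rewrite mulrCA !(addnAC _ e1.1.2.1, addnAC _ e1.1.2.2) [z + _ + _]addrAC.
Qed.

Definition tame_family (F : deriv_family) := forall i j, tame (F i j).

Lemma tame_sum (I : Type) (l : seq I) (f : I -> R * R -> R) :
  (forall e, tame (f e)) -> tame (fun z => \sum_(e <- l) f e z).
Proof.
move=> tf; elim: l => [|e l IHl].
  by under eq_fun do rewrite big_nil; exact: tame0.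
by under eq_fun do rewrite big_cons; exact: tameD.
Qed.

Lemma tame_apply_stencil l F : tame_family F -> tame_family (apply_stencil l F).
Proof.
by move=> tF i j; apply: tame_sum => e; apply: tameZ; exact: tame_translate.
Qed.

Variables (V : set (R * R)) (K : R).
Hypotheses (mV : measurable V) (VK : V `<=` box K).

Definition family_correlation (F : deriv_family) : deriv_family :=
  fun i j => correlation V (F i j).

Lemma family_correlation_stencil l F : tame_family F ->
  family_correlation (apply_stencil l F) = apply_stencil l
    (family_correlation F).
Proof.
move=> tF; apply/funext => i; apply/funext => j; apply/funext => z.
rewrite /family_correlation /correlation /apply_stencil.
have t1 : tame (\1_V) := tame_indic mV VK.
have tt (f : R * R -> R) x : tame f -> tame (fun y => f (x + y)).
  by move=> tf; under eq_fun do rewrite addrC; exact: tame_translate.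
elim: l => [|e l IHl].
  rewrite big_nil /Rintegral integral0_eq// => y _.
  by rewrite big_nil mulr0.
rewrite big_cons -IHl -RintegralZ_tame; last first.
  by apply: tameM => //; apply: tt.
rewrite -RintegralD_tame; last 2 first.
- by apply: tameZ; apply: tameM => //; apply: tt.
- apply: tameM => //.
  exact: (tt (apply_stencil l F i j) z (tame_apply_stencil l tF i j)).
apply: eq_Rintegral => y _.
by rewrite big_cons mulrDr mulrCA [z + y + _]addrAC.
Qed.

(** Families consist of true derivatives only up to a finite order, so identities are tracked up to
    order [k] in each variable; a stencil of order at most 2 in each variable costs two orders. *)
Definition agree (k : nat) (F G : deriv_family) :=
  forall i j, (i <= k)%N -> (j <= k)%N -> F i j = G i j.

Lemma agree_stencil l k F G :
  (forall e, e \in l -> (e.1.2.1 <= 2)%N /\ (e.1.2.2 <= 2)%N) ->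
  agree k.+2 F G -> agree k (apply_stencil l F) (apply_stencil l G).
Proof.
move=> l2 FG i j ik jk; apply/funext => z;
  rewrite /apply_stencil big_seq [RHS]big_seq.
by apply: eq_bigr => e /l2[e1 e2]; rewrite FG// -addn2 leq_add.
Qed.

Lemma agree_correlation k F G :
  agree k F G -> agree k (family_correlation F) (family_correlation G).
Proof. by move=> FG i j ik jk; rewrite /family_correlation FG. Qed.

Variables lE lB lN : stencil.
Hypotheses (lE2 : forall e, e \in lE -> (e.1.2.1 <= 2)%N /\ (e.1.2.2 <= 2)%N)
  (lB2 : forall e, e \in lB -> (e.1.2.1 <= 2)%N /\ (e.1.2.2 <= 2)%N)
  (lN2 : forall e, e \in lN -> (e.1.2.1 <= 2)%N /\ (e.1.2.2 <= 2)%N).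

Let sE F := apply_stencil lE (apply_stencil lN F).
Let sB F := apply_stencil lB (apply_stencil lN F).

Lemma agreeW k k' F G : (k' <= k)%N -> agree k F G -> agree k' F G.
Proof. by move=> kk FG i j ik jk; apply: FG; lia. Qed.

(** Correlation and stencils are translation invariant, hence commute, so each of the [n]
    correlations can be brought next to one [lE] and turn it into [lB]. A budget of 8 orders per
    correlation covers all the stencils applied on the way. *)
Lemma iter_family_correlation n k F : tame_family F ->
  agree (k + 8 * n) (family_correlation (apply_stencil lE F))
    (apply_stencil lB F) ->
  agree k (iter n family_correlation (iter n sE F)) (iter n sB F).
Proof.
elim: n k F => [|n IHn] k F tF FA //.
have tNF := tame_apply_stencil lN tF.
have tEF : tame_family (sE F) by exact/tame_apply_stencil.
have comm G : tame_family G ->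
    family_correlation (iter n sE G) = iter n sE (family_correlation G).
  move=> tG.
  have [_ ->//] : tame_family (iter n sE G) /\
      family_correlation (iter n sE G) = iter n sE (family_correlation G).
  elim: (n) => //= n' [tG' <-]; split; first by do 2 apply: tame_apply_stencil.
  by rewrite /sE !family_correlation_stencil//; exact: tame_apply_stencil.
have E1 : family_correlation (sE F) = apply_stencil lN
  (family_correlation (apply_stencil lE F)).
  by rewrite /sE apply_stencilC family_correlation_stencil//;
    exact: tame_apply_stencil.
have A1 : agree (k + 8 * n + 6) (family_correlation (sE F)) (sB F).
  rewrite E1 /sB apply_stencilC; apply: agree_stencil => //.
  by apply: agreeW FA; lia.
have IH2 := IHn k (sB F).
rewrite iterSr (iterSr n sE) comm//.
have step n' G H k' : agree (k' + 4 * n') G H -> agree k' (iter n' sE G)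
  (iter n' sE H).
  elim: n' k' => [|n' IH] k' GH /=; first by move: GH; rewrite muln0 addn0.
  do 2 apply: agree_stencil => //; apply: IH; apply: agreeW GH; lia.
have step2 n' G H : agree k G H ->
    agree k (iter n' family_correlation G) (iter n' family_correlation H).
  by elim: n' => //= n' IH GH; apply: agree_correlation; exact: IH.
have A2 : agree k
  (iter n family_correlation (iter n sE (family_correlation (sE F))))
    (iter n family_correlation (iter n sE (sB F))).
  by apply: step2; apply: step; apply: agreeW A1; lia.
move=> i j ik jk; rewrite A2// iterSr IH2//.
- by rewrite /sB; do 2 apply: tame_apply_stencil.
- rewrite /sB 2!(apply_stencilC lE) 2?family_correlation_stencil//;
  last 2 first.
  + exact: tame_apply_stencil.
  + by do 2 apply: tame_apply_stencil.
  rewrite [apply_stencil lB (apply_stencil lN F)]apply_stencilC.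
  by do 2 apply: agree_stencil => //; apply: agreeW FA; lia.
Qed.

End difference_operators.

Section hexagon_stencils.
Variable R : realType.

(* The derivatives along the three edge directions of the hexagon; correlating
   with the hexagon leaves first derivatives at its six vertices. *)
Definition stencil_diff : stencil R := [:: (1, (2, 1)%N, 0); (1, (1, 2)%N, 0)].

Definition stencil_vertices (r : R) : stencil R :=
  [:: (1, (1, 0)%N, (r, r)); (1, (0, 1)%N, (r, r));
      (1, (1, 0)%N, (- r, - r)); (1, (0, 1)%N, (- r, - r));
      (- 1, (1, 0)%N, (r, 0)); (- 1, (1, 0)%N, (- r, 0));
      (- 1, (0, 1)%N, (0, r)); (- 1, (0, 1)%N, (0, - r))].

(* This factor makes the edge of length [r] cancel up to a translation by
   [3 r], see [vertex_triple_sum]. *)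
Definition stencil_triple (r : R) : stencil R :=
  [:: (1, (0, 0)%N, 0); (1, (0, 0)%N, (0, r)); (1, (0, 0)%N, (0, 2 * r))].

Variables (d : R) (n : nat) (al be : nat -> R -> R) (P : R * R).
Hypotheses (Hal : bump_family d n al) (Hbe : bump_family d n be).

Definition tensor : deriv_family R :=
  fun i j z => al i (z.1 - P.1) * be j (z.2 - P.2).

Lemma tame_tensor : tame_family tensor.
Proof.
move=> i j; have [_ cal sal bal] := Hal; have [_ cbe sbe bbe] := Hbe; split.
- have mc (f : R -> R) c (p : R * R -> R) : continuous f -> measurable_fun
  setT p ->
      measurable_fun setT (fun z : R * R => f (p z - c)).
    move=> cf mp; apply: (measurableT_comp (continuous_measurable_fun cf)).
    exact: measurable_funB.
  by apply: measurable_funM; apply: mc.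
- have [A alA] := bal i; have [B beB] := bbe j.
  by exists (A * B) => z; rewrite normrM ler_pM.
- exists (d + (`|P.1| + `|P.2|)) => z zK.
  have [z1|z1] := leP d `|z.1 - P.1|; first by rewrite /tensor sal ?mul0r.
  have [z2|z2] := leP d `|z.2 - P.2|; first by rewrite /tensor sbe ?mulr0.
  exfalso; apply: zK; rewrite -[z](subrK P); apply: boxD; apply/boxP => /=.
    by rewrite !ltW.
  by rewrite lerDl lerDr.
Qed.


(** This is [hexagon_integral] with both factors translated; the bounds on [i] and [j] keep the
    derivatives involved within the families. *)
Lemma tensor_correlation (r : R) i j z : 0 < r -> (i.+2 < n)%N -> (j.+2 < n)%N
  ->
  family_correlation (hexagon r) (apply_stencil stencil_diff tensor) i j z =
  apply_stencil (stencil_vertices r) tensor i j z.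
Proof.
move=> r0 iltn jltn; have [dal cal _ bal] := Hal; have [dbe cbe _ bbe] := Hbe.
have [C [C1 C2 C3 C4]] : exists C, [/\ forall x, `|al i.+1 x| <= C,
    forall x, `|al i.+2 x| <= C, forall x, `|be j.+1 x| <= C &
    forall x, `|be j.+2 x| <= C].
  have [A1 H1] := bal i.+1; have [A2 H2] := bal i.+2.
  have [A3 H3] := bbe j.+1; have [A4 H4] := bbe j.+2.
  exists (Num.max (Num.max A1 A2) (Num.max A3 A4)).
  by split=> x; rewrite !le_max ?H1 ?H2 ?H3 ?H4 ?orbT.
have ct (f : R -> R) c : continuous f -> continuous (fun x => f (x + c)).
  move=> cf x; apply: (@continuous_comp _ _ _ (fun x => x + c)); last exact: cf.
  by apply: cvgD; [exact: cvg_id|exact: cvg_cst].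
set a := z.1 - P.1; set b := z.2 - P.2.
have := @hexagon_integral R (fun x => al i (x + a)) (fun x => al i.+1 (x + a))
  (fun x => al i.+2 (x + a)) (fun x => be j (x + b)) (fun x => be j.+1 (x + b))
  (fun x => be j.+2 (x + b))
  (is_derive_translate a (fun x => dal i x (ltnW iltn)))
  (is_derive_translate a (fun x => dal i.+1 x iltn)) (ct _ a (cal i.+2))
  (is_derive_translate b (fun x => dbe j x (ltnW jltn)))
  (is_derive_translate b (fun x => dbe j.+1 x jltn)) (ct _ b (cbe j.+2))
  C (fun x => C1 _) (fun x => C2 _) (fun x => C3 _) (fun x => C4 _) r r0.
rewrite /family_correlation /correlation /apply_stencil /stencil_diff /tensor.
have -> : \int[@area R]_w
  (\1_(hexagon r) w * (al i.+2 (w.1 + a) * be j.+1 (w.2 + b) +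
      al i.+1 (w.1 + a) * be j.+2 (w.2 + b))) =
   \int[@area R]_y (\1_(hexagon r) y * \sum_(e <- [:: (1, (2, 1)%N, 0);
     (1, (1, 2)%N, 0)])
     e.1.1 * (al (i + e.1.2.1)%N ((z + y + e.2).1 - P.1) * be (j + e.1.2.2)%N
       ((z + y + e.2).2 - P.2))).
  apply: eq_Rintegral => y _;
    rewrite !big_cons big_nil /= !mul1r !addr0 !addn2 !addn1.
  by rewrite /a /b !addrA ![y.1 + _]addrC ![y.2 + _]addrC.
move=> ->; rewrite /stencil_vertices !big_cons big_nil /= !addn0 !addn1 !mul1r
  !mulN1r !addr0.
have E (x p t : R) : x + t - p = t + (x - p) by ring.
rewrite !E -/a -/b !add0r; ring.
Qed.

End hexagon_stencils.

(** * Iterated stencils at grid points *)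

Section evaluation.
Variable R : realType.
Implicit Types (f : R * R -> R) (z : R * R).

(* The part of [stencil_vertices] that involves no derivative in the second
   coordinate. *)
Definition vertex_sum (r : R) f z : R :=
  f (z + (r, r)) + f (z + (- r, - r)) - f (z + (r, 0)) - f (z + (- r, 0)).

Definition triple_sum (r : R) f z : R :=
  f z + f (z + (0, r)) + f (z + (0, 2 * r)).

Lemma iter_stencil_eval (r r' : R) (D : nat -> set (R * R)) (F :
  deriv_family R) f m :
  (forall k z e e', D k.+1 z -> e \in stencil_vertices r ->
     e' \in stencil_triple r' -> D k (z + e.2 + e'.2)) ->
  (forall z i j, D 0%N z -> (i + j)%N = m -> F i j z = if j == 0%N then f z
    else 0) ->
  forall k i j z, D k z -> (i + j + k)%N = m ->
  iter k (fun F => apply_stencil (stencil_vertices r)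
    (apply_stencil (stencil_triple r') F)) F i j z =
  if j == 0%N then iter k (fun f => vertex_sum r (triple_sum r' f)) f z else 0.
Proof.
move=> DS F0; elim=> [|k IHk] i j z Dz ijk; first by apply: F0 => //;
  rewrite -ijk addn0.
rewrite !iterS; set G := iter k _ F in IHk *; set g := iter k _ f in IHk *.
have S e i' j' : e \in stencil_vertices r -> (i' + j' + k)%N = m ->
    apply_stencil (stencil_triple r') G i' j' (z + e.2) =
    if j' == 0%N then triple_sum r' g (z + e.2) else 0.
  move=> eB ijk'; rewrite /apply_stencil /stencil_triple !big_cons big_nil /=.
  rewrite !addn0 !mul1r !addr0 /triple_sum.
  have Dk t a b : (a, b, t) \in stencil_triple r' -> D k (z + e.2 + t).
    by move=> tN; exact: (DS k z e (a, b, t) Dz eB tN).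
  rewrite !IHk //; first by case: eqP => // _; rewrite ?addr0 ?addrA.
  - by apply: (Dk _ 1 (0, 0)%N); rewrite !inE eqxx !orbT.
  - by apply: (Dk _ 1 (0, 0)%N); rewrite !inE eqxx !orbT.
  - by rewrite -[z + e.2]addr0; apply: (Dk _ 1 (0, 0)%N); rewrite !inE eqxx.
rewrite {1}/apply_stencil big_seq.
rewrite (eq_bigr (fun e => e.1.1 * if (j + e.1.2.2)%N == 0%N then triple_sum
  r' g (z + e.2) else 0)).
  rewrite -big_seq /stencil_vertices !big_cons big_nil /= !addn0 !addn1 /=
    /vertex_sum.
  by case: eqP => _;
    rewrite !mul1r !mulN1r ?mulr0 ?oppr0 !addr0 ?add0r ?addr0 ?addrA.
move=> e eB; rewrite S//.
have -> : (i + e.1.2.1 + (j + e.1.2.2) = i + j + (e.1.2.1 + e.1.2.2))%N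
  by rewrite addnACA.
have -> : (e.1.2.1 + e.1.2.2 = 1)%N.
  by move: eB; rewrite !inE => /or4P[|||/or4P[|||/orP[]]] /eqP ->.
by rewrite addn1 addSnnS.
Qed.

End evaluation.

Section discrete.
Variable R : realType.
Implicit Types (f : R * R -> R) (z P : R * R).

(** The two vertices on each vertical edge carry opposite signs and differ by one step [l], so the
    sum over three consecutive heights telescopes. *)
Lemma vertex_triple_sum (l : R) f z :
  vertex_sum l (triple_sum l f) z =
  f (z + (l, 3 * l)) - f (z + (l, 0)) + f (z + (- l, - l)) - f
    (z + (- l, 2 * l)).
Proof.
have E (a b c e : R) : z + (a, b) + (c, e) = z + (a + c, b + e) by rewrite
  -addrA.
have E1 : l + l = 2 * l by ring.
have E2 : - l + l = 0 by ring.
have E3 : - l + 2 * l = l by ring.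
have E4 : l + 2 * l = 3 * l by ring.
by rewrite /vertex_sum /triple_sum !E !addr0 !add0r E1 E2 E3 E4; ring.
Qed.

(* For [t = 0] and [l = 1] this is the hexagonal lattice, in the same
   coordinates as [hexagon]. *)
Definition mod3_class (l : R) (t : int) : set (R * R) :=
  [set z | exists i j : int, (3 %| i + j - t)%Z /\ z = (l * i%:~R, l * j%:~R)].

(** The four translations in [vertex_triple_sum] are by (1, 3), (1, 0), (-1, -1) and (-1, 2) in
    units of [l]; each raises i + j by 1 modulo 3. *)
Lemma iter_vertex_triple_sum0 (l : R) f k t :
  (forall z, mod3_class l (t + k%:Z) z -> f z = 0) ->
  forall z, mod3_class l t z ->
    iter k (fun f => vertex_sum l (triple_sum l f)) f z = 0.
Proof.
elim: k t => [|k IHk] t f0; first by rewrite addr0 in f0.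
have {}IHk : forall z, mod3_class l (t + 1) z ->
    iter k (fun f => vertex_sum l (triple_sum l f)) f z = 0.
  by apply: IHk => z; rewrite -addrA -intS; exact: f0.
move=> _ [i [j [ij ->]]]; rewrite iterS vertex_triple_sum.
have E (a b : int) x y : (3 %| a + b - 1)%Z -> x = l * a%:~R -> y = l * b%:~R ->
    iter k (fun f => vertex_sum l (triple_sum l f)) f
      ((l * i%:~R, l * j%:~R) + (x, y)) = 0.
  move=> ab -> ->; apply: IHk; exists (i + a), (j + b); split; last first.
    by rewrite !intrD !mulrDr.
  by rewrite (_ : _ - _ = (i + j - t) + (a + b - 1)); [exact: rpredD|ring].
rewrite (E 1 3 l (3 * l)) ?(E 1 0 l 0) ?(E (-1) (-1) (- l) (- l))
  ?(E (-1) 2 (- l) (2 * l))//;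
  by rewrite ?subr0 ?addr0 ?mulrN1z ?mulrN1 ?mulr1 ?mulr0 1?mulrC.
Qed.

(* Each step moves the first coordinate by at most one, so near the extreme
   column only the two translations by [+1] contribute. *)
Lemma iter_vertex_sum_delta (l : R) P : 0 < l < 1 ->
  let psi n := iter n (fun f => vertex_sum 1 (triple_sum l f))
    (fun z => (z == P)%:R) in
  forall n, [/\
    forall z, z.1 + n%:R < P.1 -> psi n z = 0,
    forall z, z.1 + n%:R = P.1 -> P.2 < z.2 -> psi n z = 0,
    forall z, z.1 + n%:R = P.1 -> z.2 = P.2 -> psi n z = (- 1) ^+ n &
    forall z, z.1 + n%:R = P.1 -> z.2 = P.2 - l -> psi n z = (- 1) ^+ n * n%:R].
Proof.
move=> /andP[l0 l1] psi; elim=> [|n [Ha Hb Hc Hd]].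
  have psi0 z : psi 0%N z = (z == P)%:R by [].
  split=> z; rewrite ?addr0 psi0 -pair_eqE /pair_eq /=.
  - by move=> zP; rewrite lt_eqF.
  - by move=> -> zP; rewrite (gt_eqF zP) andbF.
  - by move=> -> ->; rewrite !eqxx.
  - by move=> _ ->; rewrite mulr0 (@lt_eqF _ _ (_ - _)) ?andbF//; lra.
have S z : psi n.+1 z = vertex_sum 1 (triple_sum l (psi n)) z by [].
split=> z; rewrite -natr1 => zn; rewrite S /vertex_sum /triple_sum.
- by do 12?[rewrite Ha /=; [|lra]]; lra.
- by move=> zP;
  do 12?[first [rewrite Ha /=; [|lra] | rewrite Hb /=; [|lra|lra]]]; lra.
- move=> zP; do 12?[first [rewrite Ha /=; [|lra] | rewrite Hb /=; [|lra|lra]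
    | rewrite Hc /=; [|lra|lra]]].
  by rewrite exprS; ring.
(* From [z + (1, 0)] the heights [P.2 - l] and [P.2] are seen, with values (-1)^n n and (-1)^n.
   Everything seen from [z + (1, 1)] lies above [P.2] because l < 1. *)
- move=> zP; do 12?[first [rewrite Ha /=; [|lra] | rewrite Hb /=; [|lra|lra]
    | rewrite Hc /=; [|lra|lra] | rewrite Hd /=; [|lra|lra]]].
  by rewrite exprS; ring.
Qed.

End discrete.

(** * Lattices with a regular hexagonal Voronoi cell *)

Section hexagonal_lattice.
Variable R : realType.

(* In the basis (v_0, v_2) of a regular hexagon with vertices v_k the squared
   norm is qform times the squared circumradius. *)
Definition qform (m : R * R) : R := m.1 ^+ 2 + m.2 ^+ 2 - m.1 * m.2.

(** The polarization of [qform]: the inequality [qpolar w m <= qform m] says that [w] is no farther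
    from 0 than from [m]. *)
Definition qpolar (w m : R * R) : R :=
  2 * w.1 * m.1 + 2 * w.2 * m.2 - w.1 * m.2 - w.2 * m.1.

Variable L : set (R * R).
Hypotheses (L0 : L 0) (LB : forall x y, L x -> L y -> L (x - y)).
Hypothesis LV : forall w, hexagon 1 w <-> forall m, L m -> qpolar w m <= qform
  m.

Let LN x : L x -> L (- x).
Proof. by move=> Lx; rewrite -sub0r; exact: LB. Qed.

Let LD x y : L x -> L y -> L (x + y).
Proof. by move=> Lx Ly; rewrite -[y]opprK; apply: LB => //; exact: LN. Qed.

(** Testing the cell inequality of [m] against [m] itself gives 2 [qform m] <= [qform m], and the
    form is positive definite. *)
Lemma lattice_hexagon0 m : L m -> hexagon 1 m -> m = 0.
Proof.
move=> Lm /LV/(_ _ Lm); rewrite /qpolar /qform; case: m {Lm} => x y /= h.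
have := sqr_ge0 (x - y / 2); have := sqr_ge0 (y - x / 2) => h1 h2.
by congr pair; apply/eqP; rewrite -sqrf_eq0 eq_le sqr_ge0 andbT; lra.
Qed.

(* A point just outside the cell near the midpoint (1, 1/2) of an edge is cut
   off by a lattice vector, which the two end points of the edge force to be
   close to twice the midpoint. *)
Let neighbour_approx (eta : R) : 0 < eta -> eta <= 1 ->
  exists m, [/\ L m, `|m.1 - 2| < eta & `|m.2 - 1| < eta].
Proof.
move=> eta0 eta1; pose e := eta / 16.
have e0 : 0 < e by rewrite divr_gt0.
have e1 : e <= 1 / 16 by rewrite /e; lra.
have eE : eta = 16 * e by rewrite /e; field.
have : ~ (forall m, L m -> qpolar (1 + e, (1 + e) / 2) m <= qform m).
  by move=> /LV[/=]; rewrite ler_norml; lra.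
move=> /existsNP[m /not_implyP[Lm /negP]]; rewrite -ltNge => h.
have h1 : qpolar (1, 0) m <= qform m.
  by apply: (LV _).1 => //; split => /=; rewrite ?subr0 ?normr1 ?normr0.
have h2 : qpolar (1, 1) m <= qform m.
  by apply: (LV _).1 => //; split => /=; rewrite ?subrr ?normr1 ?normr0.
exists m; move: h h1 h2; rewrite /qpolar /qform;
  case: m Lm => x y /= Lm h h1 h2.
(* In the coordinates x, u the form is u^2 + 3 x^2 / 4. Comparing [h] with [h1] and [h2] bounds u by
   a multiple of e x, which then forces x to be near 2. *)
pose u := y - x / 2.
have yE : y = u + x / 2 by rewrite /u; ring.
rewrite yE in h h1 h2 *.
have h3 : u < e * (3 / 2) * x by nra.
have h4 : - u < e * (3 / 2) * x by nra.
have x0 : 0 < x by nra.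
have x4 : x < 2 * (1 + e) by nra.
have u6 : u ^+ 2 <= (e * (3 / 2) * x) ^+ 2 by nra.
have x2 : 2 - x <= 12 * e ^+ 2.
  have : x * (2 - x) <= x * (12 * e ^+ 2) by nra.
  by rewrite ler_pM2l.
have ee : 12 * e ^+ 2 <= e by nra.
split; first by rewrite -yE.
  by rewrite ltr_norml eE; lra.
have ex : e * x <= e * 4 by nra.
by rewrite ltr_norml eE; lra.
Qed.

(** Two lattice vectors close to (2, 1) differ by a lattice vector inside the cell, hence coincide.
    An approximation better than the error of the first one therefore cannot exist unless that error
    is 0. *)
Lemma lattice_neighbour : L (2, 1).
Proof.
have [m [Lm m1 m2]] := neighbour_approx (eta := 1 / 4) ltac:(lra) ltac:(lra).
suff -> : (2, 1) = m by [].
apply/eqP; apply: contraT => mN.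
pose e := Num.max `|m.1 - 2| `|m.2 - 1|.
have e0 : 0 < e.
  rewrite lt_max !normr_gt0 !subr_eq0 -negb_and;
    apply: contra mN => /andP[/eqP a /eqP b].
  by rewrite -pair_eqE /pair_eq /= a b !eqxx.
have e1 : e <= 1 by rewrite ge_max; apply/andP; split; lra.
have [m' [Lm' m1' m2']] := neighbour_approx e0 e1.
have mm' : m - m' = 0.
  apply: lattice_hexagon0; first exact: LB.
  have e4 : e < 1 / 4 by rewrite gt_max m1 m2.
  move: m1 m2 m1' m2'; rewrite /hexagon /= !ltr_norml !ler_norml.
  by move=> ? ? ? ?; split; lra.
move/subr0_eq: mm' => mm'; subst m'.
have : Num.max `|m.1 - 2| `|m.2 - 1| < e by rewrite gt_max m1' m2'.
by rewrite -/e ltxx.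
Qed.

End hexagonal_lattice.

Lemma pair_mulrz (R : realType) (x : R * R) (i : int) :
  x *~ i = (x.1 *~ i, x.2 *~ i).
Proof.
have nat n : x *+ n = (x.1 *+ n, x.2 *+ n).
  by elim: n => [|n IHn]; rewrite ?mulr0n// !mulrS IHn.
by case: i => n; rewrite ?NegzE ?mulrNz -!pmulrn nat.
Qed.

Section hexagonal_lattice_span.
Variables (R : realType) (L : set (R * R)).
Hypotheses (L0 : L 0) (LB : forall x y, L x -> L y -> L (x - y)).
Hypothesis LV : forall w, hexagon 1 w <-> forall m, L m -> qpolar w m <= qform
  m.

Let LN x : L x -> L (- x).
Proof. by move=> Lx; rewrite -sub0r; exact: LB. Qed.

Let LD x y : L x -> L y -> L (x + y).
Proof. by move=> Lx Ly; rewrite -[y]opprK; apply: LB => //; exact: LN. Qed.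

Let LMz x (i : int) : L x -> L (x *~ i).
Proof.
move=> Lx; have nat n : L (x *+ n).
  by elim: n => [|n IHn]; rewrite ?mulr0n// mulrS; exact: LD.
by case: i => n; rewrite ?NegzE ?mulrNz -?pmulrn//; exact: LN.
Qed.

(** Exchanging the coordinates preserves the hexagon and both forms, so [lattice_neighbour] applies
    to the reflected lattice. *)
Let L12 : L (1, 2).
Proof.
apply: (@lattice_neighbour R [set m | L (m.2, m.1)]) => //=.
- by move=> x y Lx Ly; exact: (LB Lx Ly).
- move=> w; transitivity (hexagon 1 (w.2, w.1)).
    by rewrite /hexagon /= distrC; split => -[].
  split => [/LV h m /h|h]; first by rewrite /qpolar /qform /=; lra.
  apply/LV => m Lm; have := h (m.2, m.1);
    rewrite /= -surjective_pairing => /(_ Lm).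
  by rewrite /qpolar /qform /=; lra.
Qed.

(** Subtracting a suitable combination of (2, 1) and (1, 2) moves [m] into the cell, where 0 is the
    only lattice vector; both generators have coordinate sum 3. *)
Lemma lattice_mod3 m : L m -> mod3_class 1 0 m.
Proof.
move=> Lm.
pose al := (2 * m.1 - m.2) / 3; pose be := (2 * m.2 - m.1) / 3.
pose i := Num.floor al; pose j := Num.floor be.
have [i1 i2] : i%:~R <= al /\ al < i%:~R + 1.
  by have /andP[] := floor_itv al; rewrite intrD.
have [j1 j2] : j%:~R <= be /\ be < j%:~R + 1.
  by have /andP[] := floor_itv be; rewrite intrD.
have m1E : m.1 = 2 * al + be by rewrite /al /be; field.
have m2E : m.2 = al + 2 * be by rewrite /al /be; field.
have key (a b : int) : hexagon 1 (m - (2 * a%:~R + b%:~R, a%:~R + 2 * b%:~R)) ->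
    mod3_class 1 0 m.
  move=> h; exists (2 * a + b), (a + 2 * b); split.
    rewrite subr0 (_ : 2 * a + b + (a + 2 * b) = (a + b) * 3); last by ring.
    exact: dvdz_mull.
  suff /subr0_eq -> : m - (2 * a%:~R + b%:~R, a%:~R + 2 * b%:~R) = 0.
    by rewrite !mul1r !intrD !intrM.
  apply: (lattice_hexagon0 LV) h; apply: LB => //.
  rewrite (_ : (_, _) = (2, 1) *~ a + (1, 2) *~ b).
    by apply: LD; apply: LMz => //; exact: lattice_neighbour.
  by rewrite !pair_mulrz -(mulrzr 2 a) -(mulrzr 2 b).
pose s := al - i%:~R; pose t := be - j%:~R.
have H0 (a b : int) : `|2 * (s - a%:~R) + (t - b%:~R)| <= 1 ->
    `|(s - a%:~R) + 2 * (t - b%:~R)| <= 1 ->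
    `|(s - a%:~R) - (t - b%:~R)| <= 1 -> mod3_class 1 0 m.
  move=> h1 h2 h3; apply: (key (i + a) (j + b));
    rewrite /hexagon /= m1E m2E !intrD.
  split; [move: h1|move: h2|move: h3]; congr (`|_| <= 1); rewrite /s /t; ring.
have [s0 s1] : 0 <= s /\ s < 1 by rewrite /s; lra.
have [t0 t1] : 0 <= t /\ t < 1 by rewrite /t; lra.
(* The hexagons around the four corners of the fundamental parallelogram cover it; the cases select
   a corner whose hexagon contains the remainder. *)
have [a1|a1] := lerP (2 * s + t) 1; have [b1|b1] := lerP (s + 2 * t) 1.
- by apply: (H0 0 0); rewrite ?mulr0z ?mulr1z ler_norml; lra.
- by apply: (H0 0 1); rewrite ?mulr0z ?mulr1z ler_norml; lra.
- by apply: (H0 1 0); rewrite ?mulr0z ?mulr1z ler_norml; lra.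
have [st|st] := lerP s t.
  have [a2|a2] := lerP (2 * s + t) 2.
    by apply: (H0 0 1); rewrite ?mulr0z ?mulr1z ler_norml; lra.
  by apply: (H0 1 1); rewrite ?mulr1z ler_norml; lra.
have [b2|b2] := lerP (s + 2 * t) 2.
  by apply: (H0 1 0); rewrite ?mulr0z ?mulr1z ler_norml; lra.
by apply: (H0 1 1); rewrite ?mulr1z ler_norml; lra.
Qed.

End hexagonal_lattice_span.

(** * Regular hexagons in linear coordinates *)

Section regular_hexagon.
Variable R : realType.

(** With c the cosine, the triple angle formula at pi gives (2 c - 1)^2 (c + 1) = 0, and c is
    positive. *)
Lemma cos_pi_third : cos (pi / 3) = 2^-1 :> R.
Proof.
set w : R := pi / 3.
have w0 : 0 < cos w.
  by apply: cos_gt0_pihalf; have := pi_gt0 R; rewrite /w; lra.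
have piE : pi = w + w + w by rewrite /w; field.
have : cos (w + w + w) = -1 by rewrite -piE cospi.
rewrite !cosD !sinD => h; have := cos2Dsin2 w => cs.
have h2 : (2 * cos w - 1) ^+ 2 * (cos w + 1) = 0.
  have s2 : sin w ^+ 2 = 1 - cos w ^+ 2 by rewrite -cs; ring.
  have h' : cos w ^+ 3 - 3 * cos w * sin w ^+ 2 = -1 by rewrite -h; ring.
  rewrite s2 in h'.
  transitivity (cos w ^+ 3 - 3 * cos w * (1 - cos w ^+ 2) + 1); first by ring.
  by rewrite h' addNr.
move/eqP: h2; rewrite mulf_eq0 sqrf_eq0 => /orP[] /eqP; lra.
Qed.

Lemma sqr_sin_pi_third : sin (pi / 3) ^+ 2 = 3 / 4 :> R.
Proof. by have := cos2Dsin2 (pi / 3 : R); rewrite cos_pi_third => h; lra. Qed.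

Definition vertex (r theta : R) (k : nat) : R * R :=
  r *: (cos (theta + k%:R * (pi / 3)), sin (theta + k%:R * (pi / 3))).

(** Through this recurrence the vertices 0 and 2 determine all six without further trigonometry. *)
Lemma vertex_rec r theta k :
  vertex r theta k.+2 = vertex r theta k.+1 - vertex r theta k.
Proof.
set a := theta + k%:R * (pi / 3).
have e1 : theta + k.+1%:R * (pi / 3) = a + pi / 3 by rewrite -natr1 /a; ring.
have e2 : theta + k.+2%:R * (pi / 3) = a + pi / 3 + pi / 3.
  by rewrite -[k.+2]addn2 natrD /a; field.
have s2 := sqr_sin_pi_third.
rewrite /vertex e1 e2 -/a -scalerBr; congr (_ *: _); clearbody a.
apply/pair_equal_spec; rewrite !(cosD, sinD) cos_pi_third; split => /=;
  [transitivity (cos a / 4 - sin (pi / 3) * sin a - cos a * sin (pi / 3) ^+ 2)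
  |transitivity (sin a / 4 + sin (pi / 3) * cos a - sin a * sin (pi / 3) ^+ 2)];
  try (by field); by rewrite s2; field.
Qed.

Variables (r theta : R).
Hypothesis r0 : 0 < r.
Let p := vertex r theta 0.
Let q := vertex r theta 2.

Lemma sqnorm_lin_vertex w :
  (lin p q w).1 ^+ 2 + (lin p q w).2 ^+ 2 = r ^+ 2 * qform w.
Proof.
have s2 := sqr_sin_pi_third.
have qE : q = (r * (- (cos theta / 2) - sin (pi / 3) * sin theta),
               r * (- (sin theta / 2) + sin (pi / 3) * cos theta)).
  rewrite /q vertex_rec /vertex mulr0n mul0r addr0 mul1r cosD sinD cos_pi_third.
  by apply/pair_equal_spec; split => /=; rewrite /GRing.scale /=; field.
have pE : p = (r * cos theta, r * sin theta).
  by rewrite /p /vertex mul0r addr0.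
have cs : cos theta ^+ 2 = 1 - sin theta ^+ 2.
  by have := cos2Dsin2 theta => h; lra.
rewrite /lin pE qE /qform /=; case: w => x y /=.
set c := cos theta in cs *; set s := sin theta in cs *; set g := sin _ in s2 *.
transitivity (r ^+ 2 * ((x - y / 2) ^+ 2 * (c ^+ 2 + s ^+ 2) +
   y ^+ 2 * g ^+ 2 * (c ^+ 2 + s ^+ 2))); first by ring.
by rewrite cs s2; field.
Qed.

(** If the cross product vanished, (q.1, -p.1) and (q.2, -p.2) would lie in the kernel of [lin p q];
    definiteness of [qform] would make [p] zero, although (1, 0) has [qform] 1. *)
Lemma cross_vertex : cross p q != 0.
Proof.
apply/eqP => h.
have E w : lin p q w = 0 -> qform w = 0.
  move=> w0; have := sqnorm_lin_vertex w;
    rewrite w0 /= expr0n addr0 => /esym/eqP.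
  by rewrite mulf_eq0 sqrf_eq0 gt_eqF//= => /eqP.
move: (p) (q) h E => p' q' h E.
have q1 : qform ((1, 0) : R * R) = 1 by rewrite /qform /=; ring.
have l10 : lin p' q' (1, 0) = p'.
  by case: p' {h E} => ? ?; rewrite /lin /= !mulr1 !mulr0 !addr0.
have : qform (q'.1, - p'.1) = 0.
  by apply: E; rewrite /lin /=; congr pair; [ring|move: h; rewrite /cross; lra].
have : qform (q'.2, - p'.2) = 0.
  by apply: E; rewrite /lin /=; congr pair; [move: h; rewrite /cross; lra|ring].
rewrite /qform /= => h2 h1.
have p1 : p'.1 = 0.
  have := sqr_ge0 (q'.1 + p'.1 / 2) => h3.
  by apply/eqP; rewrite -sqrf_eq0 eq_le sqr_ge0 andbT; lra.
have p2 : p'.2 = 0.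
  have := sqr_ge0 (q'.2 + p'.2 / 2) => h3.
  by apply/eqP; rewrite -sqrf_eq0 eq_le sqr_ge0 andbT; lra.
have : lin p' q' (1, 0) = 0 by rewrite l10 [p']surjective_pairing p1 p2.
by move/E; rewrite q1 => /eqP; rewrite oner_eq0.
Qed.

End regular_hexagon.

Section voronoi_hexagon.
Variable R : realType.

Lemma big_ord6 (V : zmodType) (f : 'I_6 -> V) : \sum_(k < 6) f k =
  f (inord 0) + f (inord 1) + f (inord 2) + f (inord 3) + f (inord 4) + f
    (inord 5).
Proof.
rewrite !big_ord_recr big_ord0 /= add0r.
by do !congr (_ + _); congr f; apply/val_inj; rewrite /= inordK.
Qed.

(** In the coordinates given by [p] and [q] the vertices are (1, 0), (1, 1), (0, 1) and their
    negatives. *)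
Lemma hull_hexagon (c p q : R * R) (v : nat -> R * R) :
  v 0%N = p -> v 2%N = q -> (forall k, v k.+2 = v k.+1 - v k) ->
  convex_hull_of (fun k : 'I_6 => c + v k) = [set c + lin p q w | w in hexagon
    1].
Proof.
move=> v0 v2 vS.
have v1 : v 1%N = p + q by rewrite -v0 -v2 vS addrC subrK.
have v3 : v 3%N = - p by rewrite vS v2 v1 opprD addrCA subrr addr0.
have v4 : v 4%N = - p - q by rewrite vS v3 v2.
have v5 : v 5%N = - q by rewrite vS v4 v3 opprK addrAC addNr add0r.
pose pt (t0 t1 t2 t3 t4 t5 : R) : R * R :=
  (t0 + t1 - t3 - t4, t1 + t2 - t4 - t5).
have E (t : 'I_6 -> R) : \sum_(k < 6) t k = 1 ->
    \sum_(k < 6) t k *: (c + v k) = c + lin p q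
      (pt (t (inord 0)) (t (inord 1)) (t (inord 2)) (t (inord 3))
        (t (inord 4)) (t (inord 5))).
  rewrite (big_ord6 t) (big_ord6 (fun k => t k *: (c + v k))) !inordK// v0 v1
    v2 v3 v4 v5.
  set t0 := t _; set t1 := t _; set t2 := t _; set t3 := t _; set t4 := t _;
    set t5 := t _.
  move=> h; have -> : t0 = 1 - t1 - t2 - t3 - t4 - t5 by rewrite -h; ring.
  by apply/pair_equal_spec; split; rewrite /= /GRing.scale /=; ring.
apply/seteqP; split=> [x [t [t0 t1 ->]]|_ [[a b] [/= ha hb hab] <-]].
  rewrite E//;
    exists (pt (t (inord 0)) (t (inord 1)) (t (inord 2)) (t (inord 3))
      (t (inord 4)) (t (inord 5))) => //.
  have := t0 (inord 0); have := t0 (inord 1); have := t0 (inord 2).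
  have := t0 (inord 3); have := t0 (inord 4); have := t0 (inord 5).
  by move: t1; rewrite big_ord6 /pt /hexagon /= !ler_norml => *; split; lra.
have mk (t0 t1 t2 t3 t4 t5 : R) : 0 <= t0 -> 0 <= t1 -> 0 <= t2 ->
    0 <= t3 -> 0 <= t4 -> 0 <= t5 -> t0 + t1 + t2 + t3 + t4 + t5 = 1 ->
    a = t0 + t1 - t3 - t4 -> b = t1 + t2 - t4 - t5 ->
    convex_hull_of (fun k : 'I_6 => c + v k) (c + lin p q (a, b)).
  move=> h0 h1 h2 h3 h4 h5 h -> ->.
  pose t (k : 'I_6) := nth 0 [:: t0; t1; t2; t3; t4; t5] k.
  have st : \sum_(k < 6) t k = 1 by rewrite !big_ord_recr big_ord0 /= add0r.
  exists t; split=> //.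
    by case=> [[|[|[|[|[|[|k]]]]]] //= kl].
  by rewrite E// /t !inordK.
move: ha hb hab; rewrite !ler_norml => /andP[a1 a2] /andP[b1 b2] /andP[ab1 ab2].
(* In each sextant the point is a nonnegative combination of two adjacent vertices; the remaining
   weight is split evenly between the opposite vertices 0 and 3, which cancel. *)
have [a0|a0] := lerP 0 a; have [b0|b0] := lerP 0 b.
- have [ab|ab] := lerP b a.
    by apply: (mk (a - b + (1 - a) / 2) b 0 ((1 - a) / 2) 0 0); lra.
  by apply: (mk ((1 - b) / 2) a (b - a) ((1 - b) / 2) 0 0); lra.
- by apply: (mk (a + (1 - a + b) / 2) 0 0 ((1 - a + b) / 2) 0 (- b)); lra.
- by apply: (mk ((1 + a - b) / 2) 0 b (- a + (1 + a - b) / 2) 0 0); lra.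
- have [ab|ab] := lerP b a.
    by apply: (mk ((1 + b) / 2) 0 0 ((1 + b) / 2) (- a) (a - b)); lra.
  by apply: (mk ((1 + a) / 2) 0 0 (b - a + (1 + a) / 2) (- b) 0); lra.
Qed.

Lemma enorm_le (x y : R * R) :
  (enorm x <= enorm y) = (x.1 ^+ 2 + x.2 ^+ 2 <= y.1 ^+ 2 + y.2 ^+ 2).
Proof. by rewrite /enorm ler_sqrt// addr_ge0// sqr_ge0. Qed.

Lemma lin_inv (p q x : R * R) : cross p q != 0 ->
  x = lin p q (cross x q / cross p q, cross p x / cross p q).
Proof.
case: x => x y d0; rewrite /lin /= !mulrA -!mulrDl.
by congr pair; apply/esym/(canLR (mulfK d0)); rewrite /cross /=; ring.
Qed.

Lemma linD (p q w w' : R * R) : lin p q (w + w') = lin p q w + lin p q w'.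
Proof. by apply/pair_equal_spec; split => /=; ring. Qed.

Lemma linN (p q w : R * R) : lin p q (- w) = - lin p q w.
Proof. by apply/pair_equal_spec; split => /=; ring. Qed.

Lemma linZ (p q w : R * R) (k : R) : lin p q (k * w.1, k * w.2) = k *: lin p q
  w.
Proof. by apply/pair_equal_spec; split => /=; rewrite /GRing.scale /=;
  ring. Qed.

Lemma lin_inj (p q : R * R) : cross p q != 0 -> injective (lin p q).
Proof.
move=> d0 [a b] [a' b'] [/= h1 h2]; congr pair; apply: (mulIf d0);
  rewrite /cross.
- transitivity ((p.1 * a + q.1 * b) * q.2 - (p.2 * a + q.2 * b) * q.1);
  first by ring.
  by rewrite h1 h2; ring.
- transitivity ((p.2 * a + q.2 * b) * p.1 - (p.1 * a + q.1 * b) * p.2);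
  first by ring.
  by rewrite h1 h2; ring.
Qed.

Lemma voronoi_lattice_hexagon (L : set (R * R)) : is_lattice L ->
  is_regular_hexagon (voronoi L) ->
  exists p q : R * R, [/\ cross p q != 0,
    voronoi L = [set lin p q w | w in hexagon 1], L 0 &
    forall l, L l -> exists2 w, mod3_class 1 0 w & l = lin p q w].
Proof.
move=> [u [v [_ LE]]] [c [r [theta [r0 VE]]]].
have L0 : L 0 by rewrite LE; exists 0, 0; rewrite !mulr0z addr0.
have LB x y : L x -> L y -> L (x - y).
  rewrite LE => -[i [j ->]] [i' [j' ->]]; exists (i - i'), (j - j').
  by rewrite !mulrzBr opprD addrACA.
pose p := vertex r theta 0; pose q := vertex r theta 2.
have d0 : cross p q != 0 := cross_vertex theta r0.
have {}VE : voronoi L = [set c + lin p q w | w in hexagon 1].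
  by rewrite VE; apply: (hull_hexagon c (v := vertex r theta)) => // k;
    exact: vertex_rec.
have VP x : voronoi L x <-> forall l, L l -> 2 * (x.1 * l.1 + x.2 * l.2) <=
  l.1 ^+ 2 + l.2 ^+ 2.
  split => h l Ll; move: (h l Ll); rewrite enorm_le /=; lra.
have VN x : voronoi L x -> voronoi L (- x).
  move=> /VP h; apply/VP => l Ll; have := LB _ _ L0 Ll; rewrite sub0r => /h /=.
  by rewrite !sqrrN !mulrN !mulNr.
(* The cell is symmetric about 0, so its centre is 0: with g the coordinates of the centre, w to -(2
   g + w) preserves the hexagon, and the corners +-(1, 1) force g = 0. *)
have c0 : c = 0.
  have [g cE] : exists g, c = lin p q g by eexists; exact: lin_inv.
  have key w : hexagon 1 w -> hexagon 1 (- (g + g + w)).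
    move=> hw; have /VN : voronoi L (c + lin p q w) by rewrite VE; exists w.
    rewrite VE => -[w' hw']; rewrite cE -!linD -linN => /(lin_inj d0) h.
    suff -> : - (g + g + w) = w' by [].
    by rewrite -[w'](addKr g) h; apply/pair_equal_spec; split => /=; ring.
  have h1 : hexagon 1 ((1, 1) : R * R) by split => /=;
    rewrite ?subrr ?normr1 ?normr0.
  have h2 : hexagon 1 ((- 1, - 1) : R * R).
    by split => /=; rewrite ?subrr ?normrN1 ?normr0.
  have [/= + + _] := key _ h1; have [/= + + _] := key _ h2.
  rewrite cE; case: g {cE key} => a b /=; rewrite !ler_norml => *.
  have -> : a = 0 by lra.
  have -> : b = 0 by lra.
  by rewrite /lin /= !mulr0 !addr0.
have {}VE : voronoi L = [set lin p q w | w in hexagon 1].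
  by rewrite VE c0; apply/seteqP; split => _ [w hw <-]; exists w => //;
    rewrite ?add0r.
exists p, q; split=> // l Ll.
pose L' := [set w | L (lin p q w)].
have l' := lin_inv l d0; set w := (_, _) in l'.
exists w => //; apply: (@lattice_mod3 R L').
- by rewrite /L' /= /lin /= !mulr0 !addr0.
- by move=> x y; rewrite /L' /= linD linN; exact: LB.
- move=> {w l'}w.
  have rr : 0 < r ^+ 2 by rewrite exprn_gt0.
  have polar m :
    2 * ((lin p q w).1 * (lin p q m).1 + (lin p q w).2 * (lin p q m).2) =
      r ^+ 2 * qpolar w m.
    have e1 := sqnorm_lin_vertex r theta (w + m).
    have e2 := sqnorm_lin_vertex r theta w; have e3 :=
      sqnorm_lin_vertex r theta m.
    rewrite linD in e1.
    transitivity (r ^+ 2 * qform (w + m) - r ^+ 2 * qform w - r ^+ 2 * qform m).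
      by rewrite -e1 -e2 -e3 /=; ring.
    by rewrite /qform /qpolar /=; ring.
  transitivity (voronoi L (lin p q w)).
    rewrite VE; split=> [hw|[w' hw' /(lin_inj d0) <-]]//.
    by exists w.
  split=> [/VP h m /h|h].
    by rewrite polar (sqnorm_lin_vertex r theta) ler_pM2l.
  apply/VP => x Lx; rewrite (lin_inv x d0); set m := (_, _).
  rewrite polar (sqnorm_lin_vertex r theta) ler_pM2l//; apply: h.
  by rewrite /L' /= -(lin_inv x d0).
- by rewrite /L' /= -l'.
Qed.

End voronoi_hexagon.

(** * The separating test function *)

Section separating_function.
Variable R : realType.

(** Supplies bump radii: a bump around [c] narrower than [d] meets the grid at most at [c]. *)
Lemma isolated_coset (l c : R) : 0 < l ->
  exists2 d, 0 < d & forall i : int, l * i%:~R = c \/ d <= `|l * i%:~R - c|.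
Proof.
move=> l0; pose u := c / l; pose n := Num.floor u.
have cE : c = l * u by rewrite /u; field; rewrite gt_eqF.
have [n1 n2] : n%:~R <= u /\ u < n%:~R + 1.
  by have /andP[] := floor_itv u; rewrite intrD.
have far (i : int) (e : R) : e <= `|i%:~R - u| -> l * e <= `|l * i%:~R - c|.
  by move=> h; rewrite cE -mulrBr normrM gtr0_norm// ler_pM2l.
have le_int (i : int) : i%:~R <= (n%:~R : R) \/ (n%:~R : R) + 1 <= i%:~R.
  have [h|h] := leP i n; [left|right]; first by rewrite ler_int.
  by rewrite -[X in _ + X]/(1%:~R) -intrD ler_int; lia.
have [nu|nu] := eqVneq (n%:~R) u.
  exists l => // i; have [->|iN] := eqVneq i n; first by left; rewrite nu -cE.
  right; rewrite -[leLHS]mulr1; apply: far; rewrite -nu -intrB -intr_norm.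
  by rewrite -[leLHS]/(1%:~R) ler_int; lia.
have nu' : n%:~R < u by rewrite lt_neqAle nu.
exists (l * Num.min (u - n%:~R) (n%:~R + 1 - u)).
  by rewrite mulr_gt0// lt_min; apply/andP; split; lra.
move=> i; right; apply: far; rewrite ge_min.
have [h|h] := le_int i; apply/orP; [left|right].
  by rewrite distrC; apply: le_trans (ler_norm _); lra.
by apply: le_trans (ler_norm _); lra.
Qed.

(** The bound [N] matters: for irrational t / l the points with unbounded [s] accumulate
    everywhere. *)
Lemma isolated_cosets (l c t : R) (N : nat) : 0 < l ->
  exists2 d, 0 < d & forall (i : int) s, (s <= N)%N ->
    l * i%:~R + s%:R * t = c \/ d <= `|l * i%:~R + s%:R * t - c|.
Proof.
move=> l0; elim: N => [|N [d d0 IH]].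
  have [d d0 H] := isolated_coset c l0; exists d => // i s.
  by rewrite leqn0 => /eqP ->; rewrite mul0r addr0.
have [d' d'0 H] := isolated_coset (c - N.+1%:R * t) l0.
exists (Num.min d d'); first by rewrite lt_min d0.
move=> i s; rewrite leq_eqVlt => /orP[/eqP ->|]; last first.
  rewrite ltnS => /(IH i)[|h]; [by left|right].
  by apply: le_trans h; rewrite ge_min lexx.
have [h|h] := H i; [left|right]; first by rewrite h subrK.
by apply: (@le_trans _ _ d');
  [rewrite ge_min lexx orbT|rewrite opprB addrA in h].
Qed.

(* The point where the test function is centred: on the extreme column of the
   large spline, at height 0, or one fine step above if that point is reached
   by the fine stencils. *)
Lemma exists_apex (l : R) (m : nat) : 0 < l ->
  exists y, (y = 0 \/ y = l) /\ ~ mod3_class l m%:Z (m%:R, y).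
Proof.
move=> l0; have lN : l != 0 by rewrite gt_eqF.
have [[i [j [ij [mi j0]]]]|h] := pselect (mod3_class l m%:Z (m%:R, 0));
  last first.
  by exists 0; split; [left|].
exists l; split; first by right.
move=> [i' [j' [ij' [mi' lj']]]].
have ji : j = 0.
  by apply/eqP; have /esym/eqP := j0; rewrite mulf_eq0 (negPf lN) intr_eq0.
have j1 : j' = 1.
  apply/eqP; rewrite -(eqr_int R); apply/eqP; apply: (mulfI lN); rewrite -lj';
    ring.
have ii : i' = i.
  by apply/eqP; rewrite -(eqr_int R); apply/eqP; apply: (mulfI lN);
    rewrite -mi'.
subst; move: ij ij'; lia.
Qed.

Lemma iter_vertex_triple_sumZ (r l k : R) (f : R * R -> R) n z :
  iter n (fun f => vertex_sum r (triple_sum l f)) (fun z => k * f z) z =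
  k * iter n (fun f => vertex_sum r (triple_sum l f)) f z.
Proof.
elim: n z => [|n IHn] z //; rewrite !iterS /vertex_sum /triple_sum !IHn; ring.
Qed.

Lemma iter_family_correlation0 (V : set (R * R)) n (F : deriv_family R) :
  iter n (family_correlation V) F 0%N 0%N = iter n (correlation V) (F 0%N 0%N).
Proof. by elim: n => //= n <-. Qed.

Lemma stencil_vertices_int (r : R) e : e \in stencil_vertices r ->
  exists i j : int, e.2 = (r * i%:~R, r * j%:~R).
Proof.
rewrite !inE => /or4P[|||/or4P[|||/orP[]]] /eqP -> /=;
  [exists 1, 1|exists 1, 1|exists (-1), (-1)|exists (-1), (-1)|exists 1, 0|
   exists (-1), 0|exists 0, 1|exists 0, (-1)];
  by congr pair; rewrite ?mulrN1z ?mulrN1 ?mulr1z ?mulr1 ?mulr0.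
Qed.

Lemma stencil_triple_nat (l : R) e : e \in stencil_triple l ->
  exists2 s, (s <= 2)%N & e.2 = (0, s%:R * l).
Proof.
by rewrite !inE => /or3P[] /eqP -> /=; [exists 0%N|exists 1%N|exists 2%N];
  rewrite ?mul0r ?mul1r.
Qed.

Lemma separating_function (l : R) (m : nat) : 0 < l < 1 -> (0 < m)%N ->
  exists psi : R * R -> R, [/\ tame psi,
    forall z, mod3_class l 0 z -> iter m (correlation (hexagon l)) psi z = 0 &
    iter m (correlation (hexagon 1)) psi 0 != 0].
Proof.
move=> /[dup] l01 /andP[l0 l1] m0.
have [y [y0l Py]] := exists_apex m l0; pose P : R * R := (m%:R, y).
(* The radius must separate the coordinates of [P] from those reached by the stencils: multiples of
   [l] on the fine side, and on the coarse side integers in the first coordinate and integers plus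
   at most 2m steps [l] in the second. *)
have [d1 d1_gt0 D1] := isolated_coset P.1 l0.
have [d2 d2_gt0 D2] := isolated_coset P.2 l0.
have [d3 d3_gt0 D3] := isolated_coset P.1 (@ltr01 R).
have [d4 d4_gt0 D4] := isolated_cosets P.2 l (2 * m) (@ltr01 R).
pose d := Num.min (Num.min d1 d2) (Num.min d3 d4).
have d0 : 0 < d by rewrite !lt_min d1_gt0 d2_gt0 d3_gt0.
have dd x : (d1 <= x) || (d2 <= x) || (d3 <= x) || (d4 <= x) -> d <= x.
  by rewrite !ge_min => /orP[/orP[/orP[]|]|] ->; rewrite ?orbT.
(* The budget of [iter_family_correlation] asks for orders up to 8m, and [tensor_correlation] needs
   two more to stay below [n]. *)
pose n := (8 * m + 3)%N.
have [|al [be [Hal Hbe alm be0 bej]]] := @bump_families_exist R d m n d0;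
  first by rewrite /n; lia.
pose F := tensor al be P; have tF : tame_family F := tame_tensor P Hal Hbe.
pose k := al m 0 * be 0%N 0; have k0 : k != 0 by rewrite mulf_neq0.
pose good (z : R * R) :=
  (z.1 = P.1 \/ d <= `|z.1 - P.1|) /\ (z.2 = P.2 \/ d <= `|z.2 - P.2|).
have Fgood z i j : good z -> (i + j)%N = m -> F i j z = if j == 0%N then k *
  (z == P)%:R else 0.
  have [_ _ sal _] := Hal; have [_ _ sbe _] := Hbe.
  move=> [g1 g2] ij; rewrite /F /tensor -pair_eqE /pair_eq.
  case: g1 => [z1|z1]; last first.
    rewrite sal// mul0r (_ : (z.1 == P.1) = false) ?mulr0 ?if_same//.
    by apply/eqP => e; move: z1; rewrite e subrr normr0 leNgt d0.
  case: g2 => [z2|z2]; last first.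
    rewrite sbe// mulr0 (_ : (z.2 == P.2) = false) ?andbF ?mulr0 ?if_same//.
    by apply/eqP => e; move: z2; rewrite e subrr normr0 leNgt d0.
  rewrite z1 z2 !subrr !eqxx mulr1; case: eqP => [j0|/eqP jN].
    by move: ij; rewrite j0 addn0 => ->.
  by rewrite bej ?mulr0// lt0n jN -ij leq_addl.
pose sE F :=
  apply_stencil (stencil_diff R) (apply_stencil (stencil_triple l) F).
(* Used for r = l and r = 1: the triple stencil keeps step [l] in both cases, only the vertex
   stencil changes with the cell. *)
have corrE r z : 0 < r ->
    iter m (correlation (hexagon r)) (iter m sE F 0%N 0%N) z =
    iter m (fun F => apply_stencil (stencil_vertices r)
      (apply_stencil (stencil_triple l) F)) F 0%N 0%N z.
  move=> r0; rewrite -iter_family_correlation0.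
  rewrite (@iter_family_correlation R (hexagon r) r (measurable_hexagon r)
    (@hexagon_box R r)
    (stencil_diff R) (stencil_vertices r) (stencil_triple l) _ _ _ m 0 F)//.
  - by move=> e; rewrite !inE => /orP[] /eqP ->.
  - by move=> e; rewrite !inE => /or4P[|||/or4P[|||/orP[]]] /eqP ->.
  - by move=> e; rewrite !inE => /or3P[] /eqP ->.
  - move=> i j ik jk; apply/funext => z';
    apply: (tensor_correlation P Hal Hbe) => //;
      by rewrite /n addn3 !ltnS.
exists (iter m sE F 0%N 0%N); split.
- have tsE q : tame_family (iter q sE F).
    by elim: q => //= q tq; do 2 apply: tame_apply_stencil.
  exact: tsE.
- move=> z zl; rewrite corrE//.
  pose D (_ : nat) : set (R * R) :=
    [set z | exists i j : int, z = (l * i%:~R, l * j%:~R)].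
  rewrite (@iter_stencil_eval R l l D F (fun z => k * (z == P)%:R) m)//.
  + apply: (@iter_vertex_triple_sum0 R l (fun z => k * (z == P)%:R) m 0 _ z
    zl) => z' zc; have [e|] := eqVneq z' P; last by rewrite mulr0.
    by case: Py; move: zc; rewrite add0r e.
  + move=> q z' e e' [a [b ->]] /stencil_vertices_int[i [j ->]]
    /stencil_triple_nat[s _ ->].
    exists (a + i), (b + j + s%:Z); congr pair => /=; rewrite !intrD; ring.
  + move=> z' i j [a [b ->]] ij; apply: Fgood => //; split => /=.
      by have [->|h] := D1 a; [left|right; apply: dd; rewrite h].
    by have [->|h] := D2 b; [left|right; apply: dd; rewrite h ?orbT].
  + by case: zl => i [j [_ ->]]; exists i, j.
- rewrite corrE//.
  (* Each step adds at most 2 to the number [s] of fine steps, so with [q] steps to go at most 2(m -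
     q) have been used. *)
  pose D (q : nat) : set (R * R) := [set z | exists (i j : int) (s : nat),
     (s + 2 * q <= 2 * m)%N /\ z = (i%:~R, 1 * j%:~R + s%:R * l)].
  rewrite (@iter_stencil_eval R 1 l D F (fun z => k * (z == P)%:R) m)//=;
    last 3 first.
  + move=> q z' e e' [a [b [s [sm ->]]]] /stencil_vertices_int[i [j ->]].
    move=> /stencil_triple_nat[s' s2 ->].
    exists (a + i), (b + j), (s + s')%N; split.
      by apply: leq_trans sm; rewrite mulnS -addnA leq_add2l leq_add2r.
    by congr pair => /=; rewrite ?natrD !intrD; ring.
  + move=> z' i j [a [b [s [sm ->]]]] ij; apply: Fgood => //; split => /=.
      by have := D3 a; rewrite mul1r => -[->|h];
        [left|right; apply: dd; rewrite h ?orbT].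
    have sm' := leq_trans (leq_addr _ _) sm.
    by have [->|h] := D4 b s sm'; [left|right; apply: dd; rewrite h ?orbT].
  + by exists 0, 0, 0%N; rewrite mulr0 mul0r addr0; split => //; lia.
  (* The origin is [m] columns to the left of [P]; its value is, up to sign, 1 or [m] times [k],
     according to the height of the apex. *)
  rewrite iter_vertex_triple_sumZ mulf_neq0//.
  have [_ _ Hc Hd] := iter_vertex_sum_delta P l01 m.
  case: y0l => yE.
    by rewrite Hc /= ?add0r ?yE// signr_eq0.
  by rewrite Hd /= ?add0r ?yE ?subrr// mulf_neq0// ?signr_eq0// pnatr_eq0 -lt0n.
Qed.

End separating_function.

(** * Transport from hexagon coordinates to the plane *)

Definition lin_norm (R : realType) (p q : R * R) : R :=
  `|p.1| + `|q.1| + (`|p.2| + `|q.2|).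

Lemma lin_box (R : realType) (p q : R * R) (K : R) w :
  box K w -> box (K * lin_norm p q) (lin p q w).
Proof.
move=> /boxP[w1 w2]; have K0 : 0 <= K by apply: le_trans w1.
have E (a b : R) : `|a * w.1 + b * w.2| <= K * (`|a| + `|b|).
  rewrite mulrDr; apply: le_trans (ler_normD _ _) _; rewrite !normrM.
  by rewrite lerD// mulrC ler_wpM2r.
apply/boxP; split; apply: le_trans (E _ _) _; rewrite ler_wpM2l// /lin_norm.
  by rewrite lerDl addr_ge0.
by rewrite lerDr addr_ge0.
Qed.

Section linear_image.
Variables (R : realType) (p q : R * R).
Hypothesis d0 : cross p q != 0.

Definition lin_inverse (x : R * R) : R * R :=
  (cross x q / cross p q, cross p x / cross p q).

Lemma linK : cancel (lin p q) lin_inverse.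
Proof. by move=> w; apply: (lin_inj d0); rewrite -(lin_inv _ d0). Qed.

Lemma lin_inverseK : cancel lin_inverse (lin p q).
Proof. by move=> x; rewrite -(lin_inv x d0). Qed.

Lemma lin_inverseE : lin_inverse =
  lin (q.2 / cross p q, - p.2 / cross p q) (- q.1 / cross p q, p.1 / cross p q).
Proof.
by apply/funext => x; apply/pair_equal_spec; split => /=; rewrite /cross; ring.
Qed.

Lemma measurable_lin_inverse : measurable_fun setT lin_inverse.
Proof. by rewrite lin_inverseE; exact: measurable_lin. Qed.

Lemma tame_lin_inverse psi : tame psi -> tame (psi \o lin_inverse).
Proof.
move=> [mpsi [C psiC] [K psi0]]; split.
- exact: (measurableT_comp mpsi measurable_lin_inverse).
- by exists C => x /=.
- exists (K * lin_norm p q) => x xK /=; apply: psi0 => xK'; apply: xK.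
  by rewrite -[x]lin_inverseK; exact: lin_box.
Qed.

Let V r := [set lin p q w | w in hexagon r].

Lemma measurable_lin_hexagon r : measurable (V r).
Proof.
have -> : V r = setT `&` lin_inverse @^-1` hexagon r.
  rewrite setTI; apply/seteqP; split => [_ [w hw <-]|x hx] /=;
    first by rewrite linK.
  by exists (lin_inverse x) => //; rewrite lin_inverseK.
by apply: measurable_lin_inverse => //; exact: measurable_hexagon.
Qed.

Lemma lin_hexagon_box r : V r `<=` box (r * lin_norm p q).
Proof. by move=> _ [w hw <-]; apply: lin_box; exact: hexagon_box. Qed.

(** The change of variables costs only the nonzero Jacobian factor, so vanishing and non-vanishing
    carry over. *)
Lemma correlation_lin_hexagon r psi : tame psi ->
  correlation (V r) (psi \o lin_inverse) =
  (fun z => `|cross p q| * correlation (hexagon r) psi z) \o lin_inverse.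
Proof.
move=> tpsi; apply/funext => x; rewrite /correlation /=.
have t1 : tame (\1_(V r)) :=
  tame_indic (measurable_lin_hexagon r) (@lin_hexagon_box r).
have t2 : tame (fun y => \1_(V r) y * psi (lin_inverse (x + y))).
  apply: tameM => //; under eq_fun do rewrite addrC.
  exact: (@tame_translate _ (psi \o lin_inverse) x (tame_lin_inverse tpsi)).
rewrite (@Rintegral_lin R _ p q 0 d0 (tame_integrable t2)); congr (_ * _).
apply: eq_Rintegral => w _; rewrite addr0 -[in LHS](lin_inverseK x) -linD linK.
congr (_ * _); rewrite !indicE; congr ((_ : bool)%:R).
apply/idP/idP => /set_mem; last by move=> h; apply/mem_set; exists w.
by move=> [w' hw' /(lin_inj d0) <-]; exact/mem_set.
Qed.

Lemma iter_correlation_lin_hexagon r n psi : tame psi ->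
  iter n (correlation (V r)) (psi \o lin_inverse) =
  (fun z => `|cross p q| ^+ n * iter n (correlation (hexagon r)) psi z) \o
    lin_inverse.
Proof.
move=> tpsi.
have th n' : tame (iter n' (correlation (hexagon r)) psi).
  elim: n' => //= n' IH.
  exact: (tame_correlation (measurable_hexagon r) (@hexagon_box R r)).
elim: n => [|n IHn]; first by apply/funext => x /=; rewrite mul1r.
rewrite iterS IHn correlation_lin_hexagon; last exact: tameZ.
apply/funext => x /=; rewrite exprS -mulrA; congr (_ * _).
rewrite /correlation -RintegralZ_tame; last first.
  apply: tameM;
    first exact: (tame_indic (measurable_hexagon r) (@hexagon_box R r)).
  by under eq_fun do rewrite addrC; exact: tame_translate.
by apply: eq_Rintegral => y _; rewrite mulrCA.
Qed.

End linear_image.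

Lemma voronoi_scaled (R : realType) (L : set (R * R)) (p q : R * R) (l : R) :
  0 < l ->
  voronoi L = [set lin p q w | w in hexagon 1] ->
  voronoi (scaled l L) = [set lin p q w | w in hexagon l].
Proof.
move=> l0 VL; have lN : l != 0 by rewrite gt_eqF.
have nZ (x : R * R) : enorm (l *: x) = l * enorm x.
  rewrite /enorm /= /GRing.scale /= !exprMn -mulrDr sqrtrM ?sqr_ge0//
    sqrtr_sqr gtr0_norm//.
have VE x : voronoi (scaled l L) (l *: x) <-> voronoi L x.
  split=> h y => [Ly|[y' Ly' <-]].
    have := h (l *: y); rewrite -scalerBr !nZ ler_pM2l//; apply.
    by exists y.
  by rewrite -scalerBr !nZ ler_pM2l//; exact: h.
have hexE (w : R * R) : hexagon l (l *: w) <-> hexagon 1 w.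
  rewrite /hexagon /= /GRing.scale /= -mulrBr !normrM gtr0_norm//.
  by rewrite -{2 4 6}[l]mulr1 !ler_pM2l.
have linE w : l *: lin p q w = lin p q (l *: w) by rewrite -linZ.
apply/seteqP; split=> [x|_ [w hw <-]].
  rewrite -[x](scalerKV lN) => /VE; rewrite VL => -[w hw <-].
  by exists (l *: w); [exact/hexE|rewrite linE].
rewrite -[w](scalerKV lN) -linE; apply/VE; rewrite VL; exists (l^-1 *: w) => //.
by apply/hexE; rewrite scalerKV.
Qed.

(** * Pairing a representation with the test function *)

Lemma finite_int_ball (R : realType) (B : R) :
  finite_set [set i : int | `|i%:~R| <= B].
Proof.
pose N := (Num.trunc B).+1.
apply: (@sub_finite_set _ _ ((Posz @` `I_N.+1) `|` (Negz @` `I_N.+1))).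
  move=> i /= iB; have : (`|i|%:~R : R) < N%:R.
    by rewrite intr_norm; apply: le_lt_trans iB _; exact: truncnS_gt.
  rewrite -[N%:R]/(N%:~R) ltr_int.
  by case: i {iB} => k h; [left|right]; exists k => //=; lia.
by rewrite finite_setU; split; apply: finite_image; exact: finite_II.
Qed.

Theorem corollary2 (R : realType) (L : set (R * R))
    (hL : is_lattice L) (hV : is_regular_hexagon (voronoi L))
    (m : nat) (hm : (1 <= m)%N)
    (lambda : R) (hlambda0 : 0 < lambda) (hlambda1 : lambda < 1) :
  ~ (forall l : R * R, L l ->
       exists c : R * R -> R,
         {ae (@area R), forall x : R * R,
            hex_spline L m (x - l) = hex_lincomb (scaled lambda L) m c x}).
Proof.
have [p [q [d0 VL L0 Lpq]]] := voronoi_lattice_hexagon hL hV.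
(* The contradiction comes from the spline centred at the origin. *)
move=> /(_ _ L0)[c Hae].
have VlL := voronoi_scaled hlambda0 VL.
have l01 : 0 < lambda < 1 by rewrite hlambda0.
have [psi [tpsi psi0 psi1]] := separating_function l01 hm.
pose th := psi \o lin_inverse p q.
have tth : tame th := tame_lin_inverse d0 tpsi.
(* [m.-1] convolutions of an indicator function pair to [m] correlations; this is where m >= 1
   enters. *)
have mE : m = m.-1.+1 by rewrite prednK.
have pairing (M : set (R * R)) r x :
  voronoi M = [set lin p q w | w in hexagon r] ->
    tame (hex_spline M m) /\
    \int[@area R]_y (hex_spline M m (y - x) * th y) =
    `|cross p q| ^+ m * iter m (correlation (hexagon r)) psi
      (lin_inverse p q x).
  move=> VM; rewrite /hex_spline VM.
  have mV := measurable_lin_hexagon d0 r; have bV := @lin_hexagon_box R p q r.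
  split; first exact: (tame_iter_convolution mV bV).
  rewrite (iter_convolution_correlation mV bV)// -mE.
  by rewrite (iter_correlation_lin_hexagon d0).
have [tf f_int] := pairing _ _ 0 VL.
have [tg _] := pairing _ _ 0 VlL.
set f := hex_spline L m in Hae tf f_int; set g := hex_spline _ m in tg.
have [_ _ [K thK]] := tth; have [_ _ [M gM]] := tg.
(* Outside [S] the translated fine spline and [th] have disjoint supports, so against [th] the
   infinite combination becomes a finite sum that can be integrated term by term. *)
pose S := [set k | scaled lambda L k /\ box (K + M) k].
have Slam k : scaled lambda L k -> mod3_class lambda 0 (lin_inverse p q k).
  move=> [l Ll <-]; have [w [i [j [ij wE]]] lE] := Lpq l Ll.
  exists i, j; split => //; rewrite lE -linZ (linK d0) wE /=.
  by rewrite !mul1r.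
have finS : finite_set S.
  (* The bound of [lin_box] for the inverse map in the form of [lin_inverseE]; in hexagon
     coordinates the indices are [lambda] times integers, of size at most B / lambda. *)
  pose B := (K + M) * lin_norm (q.2 / cross p q, - p.2 / cross p q)
    (- q.1 / cross p q, p.1 / cross p q).
  pose I := [set i : int | `|i%:~R| <= B / lambda].
  apply: (@sub_finite_set _ _
    [set lin p q (lambda * ij.1%:~R, lambda * ij.2%:~R) | ij in I `*` I]).
    move=> k [Lk bk]; have [i [j [_ kE]]] := Slam k Lk.
    have /boxP[] : box B (lin_inverse p q k) by rewrite lin_inverseE;
      exact: lin_box.
    rewrite kE /= !normrM gtr0_norm// => i1 j1.
    exists (i, j); last by rewrite -kE lin_inverseK.
    by split; rewrite /I /= ler_pdivlMr// mulrC.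
  by apply: finite_image; apply: finite_setX; exact: finite_int_ball.
pose s := finmap.enum_fset (fset_set S).
have lincombE x : hex_lincomb (scaled lambda L) m c x * th x =
    \sum_(k <- s) c k * (g (x - k) * th x).
  have [xK|xK] := pselect (box K x); last first.
    by rewrite thK// mulr0 big1// => k _; rewrite !mulr0.
  rewrite /hex_lincomb -(@fsbig_widen _ _ _ _ S).
  - by rewrite fsbig_finite// big_distrl; apply: eq_bigr => k _; rewrite mulrA.
  - by move=> k [].
  - move=> k [/= Lk nS]; rewrite -/g gM ?mulr0// => xkM; apply: nS; split => //.
    by rewrite -[k](subKr x); apply: boxD => //; exact: boxN.
have tgk k : tame (fun x => c k * (g (x - k) * th x)).
  by apply: tameZ; apply: tameM => //; exact: (tame_translate (- k) tg).
have : \int[@area R]_x (f (x - 0) * th x) =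
    \int[@area R]_x \sum_(k <- s) c k * (g (x - k) * th x).
  rewrite /Rintegral; congr fine.
  have mfth : tame (fun x => f (x - 0) * th x).
    by apply: tameM => //; exact: (tame_translate (- 0) tf).
  have msum : tame (fun x => \sum_(k <- s) c k * (g (x - k) * th x)).
    exact: tame_sum.
  apply: ae_eq_integral => //.
  - by apply/measurable_EFinP; case: mfth.
  - by apply/measurable_EFinP; case: msum.
  - have aeF := ae_filter_ringOfSetsType (@area R).
    by apply: (filterS _ Hae) => x fx _ /=; rewrite -lincombE -fx.
rewrite f_int.
(* Every fine index has class 0 in hexagon coordinates, where the m-fold fine correlation of [psi]
   vanishes. *)
have -> : \int[@area R]_x (\sum_(k <- s) c k * (g (x - k) * th x)) = 0.
  have : forall k, k \in s -> scaled lambda L k.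
    move=> k ks; suff /set_mem[] : k \in S by [].
    by rewrite -(in_fset_set finS).
  elim: (s) => [|k s' IH] sL.
    by under eq_Rintegral do rewrite big_nil; rewrite /Rintegral integral0_eq.
  under eq_Rintegral do rewrite big_cons.
  rewrite RintegralD_tame//; last exact: tame_sum.
  rewrite IH; last by move=> k' k's; apply: sL; rewrite inE k's orbT.
  rewrite RintegralZ_tame; last by apply: tameM => //;
    exact: (tame_translate (- k) tg).
  have [_ ->] := pairing _ _ k VlL.
  by rewrite psi0 ?mulr0 ?addr0//; apply: Slam; apply: sL; rewrite inE eqxx.
have -> : lin_inverse p q 0 = 0.
  by rewrite /lin_inverse /cross /= !mulr0 !mul0r !subrr !mul0r.
by apply/eqP; rewrite mulf_neq0// expf_neq0// normr_eq0.
Qed.
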